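(* Let $k$ be a positive integer, let $(X_\lambda)_{\lambda \in \Lambda}$ and $(Y_\lambda)_{\lambda \in \Lambda}$ be two families of Banach spaces over $\mathbb{K}$, and let $Q_\lambda \in \mathcal{P}(^k X_\lambda, Y_\lambda)$ be a norm-one polynomial for every $\lambda \in \Lambda$. Let $E$ be one of $c_0$, $\ell_\infty$ or $\ell_1$, and let $X = \left[ \bigoplus_{\lambda \in \Lambda} X_\lambda \right]_E$ and $Y = \left[ \bigoplus_{\lambda \in \Lambda} Y_\lambda \right]_E$. Define the $k$-homogeneous polynomial $Q: X \rightarrow Y$ by $$Q[(x_\lambda)_{\lambda \in \Lambda}] = (Q_\lambda(x_\lambda))_{\lambda \in \Lambda}$$ for every $(x_\lambda)_{\lambda \in \Lambda} \in X$. Then $$n_{Q}^{(k)}(X, Y) \leq \inf_{\lambda\in\Lambda} n_{Q_\lambda}^{(k)}(X_\lambda, Y_\lambda).$$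
   Context: $\mathbb{K}$ is $\mathbb{R}$ or $\mathbb{C}$. For a Banach space $X$ over $\mathbb{K}$, $X^*$ is the topological dual, $B_X$ the closed unit ball and $S_X$ the unit sphere. $\left[\bigoplus_{\lambda\in\Lambda}X_\lambda\right]_E$ denotes the $E$-sum of the family: the Banach space of all families $(x_\lambda)_{\lambda\in\Lambda}$ with $x_\lambda\in X_\lambda$ and $(\|x_\lambda\|)_{\lambda}\in E(\Lambda)$, with norm $\|(\|x_\lambda\|)_\lambda\|_E$ (supremum norm for $c_0$ and $\ell_\infty$, sum of norms for $\ell_1$). A map $P:X\to Y$ is a $k$-homogeneous polynomial if there is a $k$-linear map $A:X^k\to Y$ with $P(x)=A(x,\dots,x)$ for all $x\in X$. $\mathcal{P}(^k X,Y)$ is the Banach space of continuous $k$-homogeneous polynomials from $X$ to $Y$ with norm $\|P\|=\sup_{x\in B_X}\|P(x)\|$. For $Q\in\mathcal{P}(^kX,Y)$ with $\|Q\|=1$ and $P\in\mathcal{P}(^kX,Y)$, let $V_Q(P) := \bigcap_{\delta > 0} \overline{\{y^*(P(x)) : y^* \in S_{Y^*},\ x \in S_X,\ \operatorname{Re} y^*(Q(x))>1-\delta\}}$ and $v_Q(P) := \sup\{|t| : t \in V_Q(P)\}$. The polynomial numerical index of $(X,Y)$ with respect to $Q$ is $n_Q^{(k)}(X,Y):=\inf\{v_Q(P):P\in \mathcal{P}(^k X,Y),\ \|P\|=1\}$. *)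

(* Defs.v *)
From HB Require Import structures.
From mathcomp Require Import all_boot all_order all_algebra finmap complex.
From mathcomp Require Import all_classical all_reals all_analysis.

Set Implicit Arguments.
Unset Strict Implicit.
Unset Printing Implicit Defensive.

Import Order.TTheory GRing.Theory Num.Theory.
Import numFieldNormedType.Exports.

Local Open Scope classical_set_scope.
Local Open Scope ring_scope.
Local Open Scope complex_scope.

Variant scalar_kind := RealScalars | ComplexScalars.

Definition scalars (R : realType) (s : scalar_kind) : numFieldType :=
  match s with RealScalars => R | ComplexScalars => R[i] end.

Definition realpart (R : realType) (s : scalar_kind) : scalars R s -> R :=
  match s with RealScalars => id | ComplexScalars => @complex.Re R end.

Definition of_real (R : realType) (s : scalar_kind) : R -> scalars R s :=
  match s with RealScalars => id | ComplexScalars => real_complex R end.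

(* Norms of normedModType K are K-valued; rnorm is their real value. *)
Definition rnorm (R : realType) (s : scalar_kind)
  (X : normedModType (scalars R s)) (x : X) : R := realpart `|x|.

Arguments of_real {R} s.

Section ScalarTheory.
Variables (R : realType) (s : scalar_kind).
Local Notation K := (scalars R s).

Lemma of_realD a b : of_real s (a + b) = of_real s a + of_real s b :> K.
Proof. by case: s => //=; rewrite raddfD. Qed.

Lemma of_realM a b : of_real s (a * b) = of_real s a * of_real s b :> K.
Proof. by case: s => //=; rewrite rmorphM. Qed.

Lemma of_real0 : of_real s 0 = 0 :> K.
Proof. by case: s. Qed.

Lemma of_real1 : of_real s 1 = 1 :> K.
Proof. by case: s. Qed.

Lemma of_realK a : realpart (of_real s a : K) = a.
Proof. by case: s. Qed.

Lemma realpartK (z : K) : 0 <= z -> of_real s (realpart z) = z.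
Proof.
case: s z => //= z; rewrite lecE => /andP[/eqP h _].
by case: z h => a b /= ->.
Qed.

Lemma ler_of_real a b : (of_real s a <= of_real s b :> K) = (a <= b).
Proof. by case: s => //=; rewrite lecR. Qed.

Lemma ltr_of_real a b : (of_real s a < of_real s b :> K) = (a < b).
Proof. by case: s => //=; rewrite ltcR. Qed.

Lemma of_real_norm a : `|of_real s a : K| = of_real s `|a|.
Proof. by case: s => //=; rewrite normc_def/= expr0n addr0 sqrtr_sqr. Qed.

Section Norm.
Variable X : normedModType K.
Implicit Types x y : X.

Lemma of_rnorm x : of_real s (rnorm x) = `|x|.
Proof. exact: realpartK. Qed.

Lemma rnorm_ge0 x : 0 <= rnorm x.
Proof. by rewrite -ler_of_real of_rnorm of_real0. Qed.

Lemma rnormD x y : rnorm (x + y) <= rnorm x + rnorm y.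
Proof. by rewrite -ler_of_real of_realD !of_rnorm ler_normD. Qed.

Lemma rnormN x : rnorm (- x) = rnorm x.
Proof. by rewrite /rnorm normrN. Qed.

Lemma rnormZ (c : K) x : rnorm (c *: x) = rnorm (c : K^o) * rnorm x.
Proof.
rewrite -[LHS]of_realK of_rnorm normrZ -(of_rnorm x).
by rewrite -[X in X * _]realpartK// -of_realM of_realK.
Qed.

Lemma rnormZr (a : R) x : rnorm (of_real s a *: x) = `|a| * rnorm x.
Proof. by rewrite rnormZ /rnorm of_real_norm of_realK. Qed.

Lemma rnorm0 : rnorm (0 : X) = 0.
Proof. by rewrite /rnorm normr0 -of_real0 of_realK. Qed.

Lemma rnorm_eq0 x : rnorm x = 0 -> x = 0.
Proof. by move=> h; apply/normr0_eq0; rewrite -of_rnorm h of_real0. Qed.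

Lemma rnorm_sum (I : finType) (F : I -> X) :
  rnorm (\sum_i F i) <= \sum_i rnorm (F i).
Proof.
elim/big_ind2: _ => // [|x1 x2 y1 y2 h1 h2]; first by rewrite rnorm0.
by apply: le_trans (rnormD _ _) _; exact: lerD.
Qed.

Lemma rnorm_normalize x :
  exists2 u : X, rnorm u <= 1 & x = of_real s (rnorm x) *: u.
Proof.
have [x0|x0] := eqVneq (rnorm x) 0.
  exists 0; first by rewrite rnorm0.
  by rewrite scaler0; exact: rnorm_eq0.
exists (of_real s (rnorm x)^-1 *: x).
  by rewrite rnormZr ger0_norm ?invr_ge0 ?rnorm_ge0// mulVf.
by rewrite scalerA -of_realM mulfV// of_real1 scale1r.
Qed.

End Norm.
End ScalarTheory.

Section Polynomials.
Variables (R : realType) (s : scalar_kind).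
Local Notation K := (scalars R s).
Variable k : nat.

Definition multilinear (X Y : normedModType K) (A : ('I_k -> X) -> Y) : Prop :=
  forall (i : 'I_k) (v : 'I_k -> X), linear (fun u : X => A (dfwith v i u)).

Definition homogeneous (X Y : normedModType K) (P : X -> Y) : Prop :=
  exists2 A : ('I_k -> X) -> Y, multilinear A & forall x, P x = A (fun=> x).

Record hpoly (X Y : completeNormedModType K) := HPoly {
  hpoly_fun :> X -> Y ;
  hpoly_homogeneous : homogeneous hpoly_fun ;
  hpoly_continuous : continuous hpoly_fun }.

(* sup of |f| over the closed unit ball: the norm of a continuous
   homogeneous polynomial as well as of a continuous functional. *)
Definition ball_norm (X Y : normedModType K) (f : X -> Y) : \bar R :=
  ereal_sup [set (rnorm (f x))%:E | x in [set x : X | rnorm x <= 1]].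

Section NumericalIndex.
Variables X Y : completeNormedModType K.
Implicit Types Q P : hpoly X Y.

Definition approx_numerical_range Q P (d : R) : set K^o :=
  [set t | exists (f : {linear Y -> K^o}) (x : X),
    [/\ continuous f, ball_norm f = 1%E, rnorm x = 1,
        1 - d < realpart (f (Q x)) & t = f (P x)]].

Definition numerical_range Q P : set K^o :=
  \bigcap_(d in [set d : R | 0 < d]) closure (approx_numerical_range Q P d).

Definition numerical_radius Q P : \bar R :=
  ereal_sup [set (rnorm t)%:E | t in numerical_range Q P].

(* Intended for ball_norm Q = 1.  Suprema and infima are taken in \bar R, so
   that no junk value arises; in particular ereal_inf set0 = +oo. *)
Definition numerical_index Q : \bar R :=
  ereal_inf [set numerical_radius Q P
            | P in [set P : hpoly X Y | ball_norm P = 1%E]].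

End NumericalIndex.
End Polynomials.

Section LinearMap.
Variables (K : numFieldType) (X Y : lmodType K) (g : X -> Y).
Hypothesis lg : linear g.

Lemma linear_mapD : {morph g : x y / x + y}.
Proof. by move=> x y; rewrite -{1}[x]scale1r lg scale1r. Qed.

Lemma linear_map0 : g 0 = 0.
Proof. by apply: (@addIr _ (g 0)); rewrite -linear_mapD !add0r. Qed.

Lemma linear_mapZ c x : g (c *: x) = c *: g x.
Proof. by rewrite -[c *: x]addr0 lg linear_map0 addr0. Qed.

End LinearMap.

Section Multilinear.
Variables (R : realType) (s : scalar_kind).
Local Notation K := (scalars R s).
Variables X Y : normedModType K.

Definition fcons k (u : X) (v : 'I_k -> X) (i : 'I_k.+1) : X :=
  if unlift ord0 i is Some j then v j else u.

Lemma fconsE k (w : 'I_k.+1 -> X) :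
  w = fcons (w ord0) (fun j => w (lift ord0 j)).
Proof.
by apply/funext => i; rewrite /fcons; case: unliftP => [j ->|->].
Qed.

Lemma dfwith_fcons0 k u u' (v : 'I_k -> X) :
  dfwith (fcons u v) ord0 u' = fcons u' v.
Proof.
rewrite [LHS]fconsE dfwithin; congr fcons; apply/funext => j.
by rewrite dfwithout// /fcons liftK.
Qed.

Lemma dfwith_fcons k u (v : 'I_k -> X) i w :
  dfwith (fcons u v) (lift ord0 i) w = fcons u (dfwith v i w).
Proof.
rewrite [LHS]fconsE dfwithout; last by rewrite eq_sym neq_lift.
congr fcons; first by rewrite /fcons unlift_none.
apply/funext => j.
have [->|ij] := eqVneq i j; first by rewrite !dfwithin.
by rewrite !dfwithout ?(inj_eq lift_inj)// /fcons liftK.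
Qed.

Section Cons.
Variables (k : nat) (A : ('I_k.+1 -> X) -> Y).
Hypothesis mA : multilinear A.

Lemma multilinear_head (v : 'I_k -> X) : linear (fun u => A (fcons u v)).
Proof.
move=> a x y; have := mA ord0 (fcons 0 v) a x y.
by rewrite !dfwith_fcons0.
Qed.

Lemma multilinear_tail u : multilinear (fun v => A (fcons u v)).
Proof.
move=> i v a x y; have := mA (lift ord0 i) (fcons u v) a x y.
by rewrite !dfwith_fcons.
Qed.

End Cons.

Lemma multilinear_sum (J : finType) k (A : ('I_k -> X) -> Y)
    (B : 'I_k -> J -> X) : multilinear A ->
  A (fun i => \sum_j B i j) = \sum_(f : {ffun 'I_k -> J}) A (fun i => B i (f i)).
Proof.
elim: k A B => [|k IH] A B mA.
  rewrite (eq_bigr (fun=> A (fun i => \sum_j B i j))); last first.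
    by move=> f _; congr A; apply/funext => -[].
  by rewrite sumr_const card_ffun card_ord expn0.
rewrite [in LHS](fconsE (fun i => \sum_j B i j)).
rewrite (big_morph _ (linear_mapD (multilinear_head mA _))
                     (linear_map0 (multilinear_head mA _))).
under eq_bigr => j _ do rewrite (IH _ _ (multilinear_tail mA _)).
rewrite pair_big /=.
pose h (p : J * {ffun 'I_k -> J}) : {ffun 'I_k.+1 -> J} :=
  [ffun i => if unlift ord0 i is Some j then p.2 j else p.1].
pose h' (f : {ffun 'I_k.+1 -> J}) : J * {ffun 'I_k -> J} :=
  (f ord0, [ffun i => f (lift ord0 i)]).
have hK : cancel h h'.
  move=> [a f]; rewrite /h' /h !ffunE unlift_none; congr pair.
  by apply/ffunP => i; rewrite !ffunE liftK.
have h'K : cancel h' h.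
  by move=> f; apply/ffunP => i; rewrite /h' /h ffunE;
    case: unliftP => [j ->|->] /=; rewrite ?ffunE.
rewrite [RHS](reindex h) /=; last by exists h' => ? _.
apply: eq_bigr => -[a f] _; congr A; apply/funext => i.
by rewrite /fcons /h ffunE; case: unliftP => [j ->|->].
Qed.

Lemma multilinear_scale k (A : ('I_k -> X) -> Y) (c : 'I_k -> K)
    (v : 'I_k -> X) : multilinear A ->
  A (fun i => c i *: v i) = (\prod_i c i) *: A v.
Proof.
elim: k A c v => [|k IH] A c v mA.
  by rewrite big_ord0 scale1r; congr A; apply/funext => -[].
rewrite [in LHS](fconsE (fun i => c i *: v i)).
rewrite (linear_mapZ (multilinear_head mA _)).
rewrite (IH _ _ _ (multilinear_tail mA _)) scalerA -big_ord_recl /=.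
by congr (_ *: A _); rewrite [RHS]fconsE.
Qed.

Lemma homogeneous_scale k (P : X -> Y) c x : homogeneous k P ->
  P (c *: x) = c ^+ k *: P x.
Proof.
move=> [A mA PA]; rewrite !PA (multilinear_scale (fun=> c) (fun=> x) mA).
by rewrite prodr_const card_ord.
Qed.

End Multilinear.

Section Polarization.
Variables (R : realType) (s : scalar_kind).
Local Notation K := (scalars R s).
Variables (k : nat) (X Y : normedModType K).

Definition polar_sign (T : {ffun 'I_k -> bool}) : K :=
  \prod_j (if T j then 1 else -1).

Definition polar (P : X -> Y) (v : 'I_k -> X) : Y :=
  (k`!%:R)^-1 *: \sum_(T : {ffun 'I_k -> bool})
    polar_sign T *: P (\sum_j if T j then v j else 0).

Lemma polar_sign_sum (f : {ffun 'I_k -> 'I_k}) :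
  \sum_T polar_sign T * \prod_i (if T (f i) then 1 else 0) =
  (injectiveb f)%:R :> K.
Proof.
transitivity (\sum_(T : {ffun 'I_k -> bool}) \prod_j
   (if T j then 1 else if j \in codom f then 0 else -1) : K).
  apply: eq_bigr => T _; rewrite /polar_sign.
  have [/forallP fT|] := boolP [forall i, T (f i)].
    rewrite [X in _ * X]big1 ?mulr1; last by move=> i _; rewrite fT.
    apply: eq_bigr => j _; case: ifP => // Tj; case: ifP => // /codomP[i ji].
    by rewrite ji fT in Tj.
  rewrite negb_forall => /existsP[i /negbTE Ti].
  rewrite [X in _ * X](bigD1 i)//= Ti mul0r mulr0.
  by rewrite (bigD1 (f i))//= Ti codom_f mul0r.
rewrite -(bigA_distr_bigA (fun j (b : bool) =>
  if b then 1 else if j \in codom f then 0 else -1 : K)).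
have [/injectiveP fI|fI] := boolP (injectiveb f).
  rewrite big1// => j _; rewrite big_bool/=.
  have [g fg gf] := injF_bij fI.
  by rewrite ifT ?addr0//; apply/codomP; exists (g j).
suff [j jf] : exists j, j \notin codom f.
  by rewrite (bigD1 j)//= big_bool/= (negbTE jf) subrr mul0r.
apply/existsP; rewrite -negb_forall; apply: contra fI => /forallP fS.
have /image_injP fI : #|codom f| == #|'I_k|.
  by apply/eqP/eq_card => j; rewrite fS.
by apply/injectiveP => x y; exact: fI.
Qed.

Lemma polarE (P : X -> Y) (A : ('I_k -> X) -> Y) v :
  multilinear A -> (forall x, P x = A (fun=> x)) ->
  polar P v = (k`!%:R)^-1 *:
    \sum_(f : {ffun 'I_k -> 'I_k} | injectiveb f) A (v \o f).
Proof.
move=> mA PA; congr (_ *: _).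
transitivity (\sum_(T : {ffun 'I_k -> bool}) \sum_(f : {ffun 'I_k -> 'I_k})
   (polar_sign T * \prod_i (if T (f i) then 1 else 0)) *: A (v \o f)).
  apply: eq_bigr => T _; rewrite PA.
  rewrite (multilinear_sum (fun=> fun j => if T j then v j else 0) mA).
  rewrite scaler_sumr; apply: eq_bigr => f _; rewrite -scalerA; congr (_ *: _).
  rewrite -(multilinear_scale _ _ mA); congr A; apply/funext => i /=.
  by case: ifP => _; rewrite ?scale1r ?scale0r.
rewrite exchange_big /= [RHS]big_mkcond; apply: eq_bigr => f _.
by rewrite -scaler_suml polar_sign_sum; case: ifP; rewrite ?scale1r ?scale0r.
Qed.

Lemma polar_multilinear (P : X -> Y) : homogeneous k P -> multilinear (polar P).
Proof.
move=> [A mA PA] i v c x y; rewrite !(polarE _ mA PA).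
rewrite [X in _ = X + _]scalerA mulrC -scalerA -scalerDr; congr (_ *: _).
rewrite scaler_sumr -big_split /=.
apply: eq_bigr => f /injectiveP /injF_bij[g fg gf].
have E w : dfwith v i w \o f = dfwith (v \o f) (g i) w.
  apply/funext => j /=; have [<-|ij] := eqVneq (g i) j.
    by rewrite -{1}(gf i) !dfwithin.
  rewrite !dfwithout//; apply: contra ij => /eqP ->.
  by rewrite fg.
by rewrite !E; exact: mA.
Qed.

Lemma polar_diag (P : X -> Y) x : homogeneous k P -> polar P (fun=> x) = P x.
Proof.
move=> [A mA PA]; rewrite (polarE _ mA PA).
rewrite (eq_bigr (fun=> P x)); last by move=> f _; rewrite PA.
rewrite sumr_const.
have -> : #|[pred f : {ffun 'I_k -> 'I_k} | injectiveb f]| = k`!.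
  have := card_inj_ffuns 'I_k 'I_k; rewrite !card_ord ffactnn => <-.
  by rewrite cardsE.
by rewrite -(scaler_nat (k`!) (P x)) scalerA mulVf ?scale1r// pnatr_eq0 -lt0n fact_gt0.
Qed.

Lemma rnorm_polar_sign (T : {ffun 'I_k -> bool}) (y : Y) :
  rnorm (polar_sign T *: y) = rnorm y.
Proof.
rewrite /rnorm normrZ /polar_sign normr_prod big1 ?mul1r// => i _.
by case: ifP => _; rewrite ?normrN normr1.
Qed.

Lemma rnorm_polar_le (P : X -> Y) (M : R) : homogeneous k P ->
  (forall x, rnorm x <= 1 -> rnorm (P x) <= M) ->
  exists2 C : R, 0 <= C &
    forall v, rnorm (polar P v) <= C * \prod_i rnorm (v i).
Proof.
move=> hP PM.
have M0 : 0 <= M by apply: le_trans (PM 0 _); rewrite ?rnorm_ge0 ?rnorm0.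
have PM' x : rnorm (P x) <= M * rnorm x ^+ k.
  have [u u1 {1}->] := rnorm_normalize x.
  rewrite (homogeneous_scale _ _ hP).
  have -> : of_real s (rnorm x) ^+ k = of_real s (rnorm x ^+ k) :> K.
    by elim: k => [|m IH]; rewrite ?of_real1// !exprS of_realM IH.
  rewrite rnormZr ger0_norm ?exprn_ge0 ?rnorm_ge0// mulrC ler_wpM2r//.
    by rewrite exprn_ge0 ?rnorm_ge0.
  exact: PM.
pose C := rnorm ((k`!%:R)^-1 : K^o) *
  \sum_(T : {ffun 'I_k -> bool}) M * (k%:R) ^+ k.
exists C; first by rewrite mulr_ge0 ?rnorm_ge0 ?sumr_ge0// => T _;
  rewrite mulr_ge0 ?exprn_ge0.
have C1 v : (forall i, rnorm (v i) <= 1) -> rnorm (polar P v) <= C.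
  move=> v1; rewrite rnormZ ler_wpM2l ?rnorm_ge0//.
  apply: le_trans (rnorm_sum _) _; apply: ler_sum => T _.
  rewrite rnorm_polar_sign; apply: le_trans (PM' _) _.
  rewrite ler_wpM2l// lerXn2r ?nnegrE ?rnorm_ge0//.
  apply: le_trans (rnorm_sum _) _.
  rewrite -[leRHS](_ : \sum_(i < k) (1 : R) = k%:R); last first.
    by rewrite sumr_const card_ord.
  by apply: ler_sum => i _; case: ifP => _; rewrite ?rnorm0.
move=> v; have /choice[u uP] : forall i, exists u : X,
    rnorm u <= 1 /\ v i = of_real s (rnorm (v i)) *: u.
  by move=> i; have [u u1 vu] := rnorm_normalize (v i); exists u.
have {1}-> : v = (fun i => of_real s (rnorm (v i)) *: u i).
  by apply/funext => i; case: (uP i).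
rewrite (multilinear_scale _ _ (polar_multilinear hP)).
have -> : \prod_i of_real s (rnorm (v i)) = of_real s (\prod_i rnorm (v i)) :> K.
  by apply/esym/(big_morph _ (@of_realM _ _) (@of_real1 _ _)).
have pv : 0 <= \prod_i rnorm (v i) by apply: prodr_ge0 => i _; exact: rnorm_ge0.
rewrite rnormZr ger0_norm// mulrC ler_wpM2r// C1// => i.
by case: (uP i).
Qed.

End Polarization.

Section Continuity.
Variables (R : realType) (s : scalar_kind).
Local Notation K := (scalars R s).
Variables (k : nat) (X Y : normedModType K).

Lemma homogeneous_bounded_continuous (P : X -> Y) (M : R) : homogeneous k P ->
  (forall x, rnorm x <= 1 -> rnorm (P x) <= M) -> continuous P.
Proof.
move=> hP PM; have [C C0 AC] := rnorm_polar_le hP PM.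
have mA := polar_multilinear hP; set A := polar P in mA AC.
move=> x; pose m := 1 + rnorm x.
have m1 : 1 <= m by rewrite lerDl rnorm_ge0.
have m0 : 0 <= m := le_trans ler01 m1.
pose D := C * m ^+ k *+ #|{ffun 'I_k -> bool}|.
have D0 : 0 <= D by rewrite mulrn_wge0// mulr_ge0// exprn_ge0.
have PD h : rnorm h <= 1 -> rnorm (P (x + h) - P x) <= D * rnorm h.
  move=> h1; rewrite -!(polar_diag _ hP) -/A.
  have -> : (fun=> x + h) =
      (fun _ : 'I_k => \sum_(b : bool) if b then h else x).
    by apply/funext => i; rewrite big_bool/= addrC.
  rewrite (multilinear_sum (fun=> fun b : bool => if b then h else x) mA).
  rewrite (bigD1 [ffun=> false])//= addrAC.
  have -> : (fun i : 'I_k => if [ffun=> false] i then h else x) = (fun=> x).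
    by apply/funext => i; rewrite ffunE.
  rewrite subrr add0r big_mkcond /=.
  apply: le_trans (rnorm_sum _) _.
  rewrite /D mulrnAl -sumr_const; apply: ler_sum => f _.
  case: ifPn => [f0|_]; last first.
    by rewrite rnorm0 mulr_ge0 ?rnorm_ge0// mulr_ge0// exprn_ge0.
  have [i fi] : exists i, f i.
    apply/existsP; apply: contraR f0; rewrite negb_exists => /forallP f0.
    by apply/eqP/ffunP => i; rewrite ffunE; apply/negbTE.
  apply: le_trans (AC _) _; rewrite -mulrA ler_wpM2l//.
  rewrite (bigD1 i)//= fi mulrC ler_wpM2r ?rnorm_ge0//.
  have <- : \prod_(j < k) m = m ^+ k by rewrite prodr_const card_ord.
  rewrite [leRHS](bigD1 i)//= -[leLHS]mul1r.
  apply: ler_pM => //; first by apply: prodr_ge0 => j _; exact: rnorm_ge0.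
  apply: ler_prod => j _; rewrite rnorm_ge0/=; case: ifP => _.
    exact: le_trans h1 m1.
  by rewrite lerDr.
apply/cvgrPdist_le => /= e e0.
have eE : e = of_real s (realpart e) by rewrite realpartK// ltW.
have e0' : 0 < realpart e by rewrite -(@ltr_of_real _ s) -eE of_real0.
pose d := Num.min 1 (realpart e / (1 + D)).
have D1 : 0 < 1 + D by rewrite ltr_wpDr.
have d0 : 0 < of_real s d.
  by rewrite -of_real0 ltr_of_real lt_min ltr01 divr_gt0.
near=> y; have : `|x - y| <= of_real s d.
  by near: y; exact: cvgr_dist_le.
rewrite -of_rnorm ler_of_real le_min => /andP[y1 yd].
rewrite -of_rnorm eE ler_of_real -rnormN opprB.
have -> : y = x + (y - x) by rewrite addrC subrK.
have yx : rnorm (y - x) = rnorm (x - y) by rewrite -rnormN opprB.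
apply: (le_trans (PD _ _)); rewrite yx//.
rewrite ler_pdivlMr// in yd; apply: le_trans yd.
by rewrite mulrC ler_wpM2l ?rnorm_ge0// lerDr.
Unshelve. all: by end_near. Qed.

End Continuity.

Variant sum_kind := c0_sum | linfty_sum | l1_sum.

Section FamilySpaces.
Variables (R : realType) (E : sum_kind) (L : choiceType).
Implicit Types a b c : L -> R.

Definition family_space : set (L -> R) :=
  match E with
  | c0_sum => [set a : L -> R | forall e : R, 0 < e -> finite_set [set l | e <= `|a l|]]
  | linfty_sum => [set a : L -> R | exists M : R, forall l, `|a l| <= M]
  | l1_sum => [set a : L -> R | summable [set: L] (EFin \o a)]
  end.

Definition family_norm a : R :=
  match E with
  | c0_sum | linfty_sum => sup (range (fun l => `|a l|))
  | l1_sum => fine (\esum_(l in [set: L]) (`|a l|)%:E)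
  end.

(* The norms of all three spaces are suprema of the finite sums psum s a,
   with s ranging over finite subsets for l1 and over singletons otherwise. *)
Definition test (s : seq L) : bool :=
  if E is l1_sum then uniq s else (size s <= 1)%N.

Definition psum (s : seq L) a : R := \sum_(l <- s) `|a l|.

Definition psum_bounded a (M : R) : Prop := forall s, test s -> psum s a <= M.

Definition vanishing a : Prop := if E is c0_sum then
  forall e : R, 0 < e -> finite_set [set l | e <= `|a l|] else True.

Lemma test_sup a M : E <> l1_sum -> 0 <= M ->
  (forall l, `|a l| <= M) -> psum_bounded a M.
Proof.
move=> El1 M0 aM [|l [|l' s]]; rewrite /test /psum ?big_nil ?big_seq1//.
by case: E El1.
Qed.

Lemma test1 l : test [:: l].
Proof. by rewrite /test; case: E. Qed.

Lemma psum1 l a : psum [:: l] a = `|a l|.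
Proof. by rewrite /psum big_seq1. Qed.

Lemma test0 : test [::].
Proof. by rewrite /test; case: E. Qed.

Lemma psum_bounded_ge0 a M : psum_bounded a M -> 0 <= M.
Proof. by move=> /(_ _ test0); rewrite /psum big_nil. Qed.

Lemma esum_le_psum a (M : R) : E = l1_sum -> psum_bounded a M ->
  (\esum_(l in [set: L]) (`|a l|)%:E <= M%:E)%E.
Proof.
move=> El1 aM; apply: ge_ereal_sup => /= _ [A [Afin _] <-].
rewrite fsbig_finite//= sumEFin lee_fin; apply: aM.
by rewrite /test El1 fset_uniq.
Qed.

Lemma psum_le_esum a s : E = l1_sum -> test s ->
  ((psum s a)%:E <= \esum_(l in [set: L]) (`|a l|)%:E)%E.
Proof.
rewrite /test => -> us; apply: ereal_sup_ubound.
exists [set` s]; first by split.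
by rewrite -fsbig_seq// sumEFin.
Qed.

Lemma family_spaceP a :
  family_space a <-> (exists M, psum_bounded a M) /\ vanishing a.
Proof.
have supE : E <> l1_sum ->
    (exists M : R, forall l, `|a l| <= M) <-> exists M, psum_bounded a M.
  move=> El1; split => -[M aM].
    exists (Num.max 0 M); apply: test_sup => //; first by rewrite le_max lexx.
    by move=> l; rewrite le_max aM orbT.
  by exists M => l; rewrite -psum1; apply: aM; exact: test1.
have l1E : E = l1_sum -> summable [set: L] (EFin \o a) <->
    exists M, psum_bounded a M.
  move=> El1; split => [sa|[M aM]].
    have sfin : \esum_(l in [set: L]) (`|a l|)%:E \is a fin_num.
      by rewrite ge0_fin_numE// esum_ge0.
    exists (fine (\esum_(l in [set: L]) (`|a l|)%:E)) => s ts.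
    by rewrite -lee_fin fineK//; exact: psum_le_esum.
  by apply: (le_lt_trans (esum_le_psum El1 aM)); exact: ltry.
rewrite /family_space /vanishing; case: E supE l1E => supE l1E.
- split => [va|[]//]; split => //; apply/supE => //.
  have A1 := va 1 ltr01.
  exists (1 + \sum_(l <- fset_set [set l | 1 <= `|a l|]) `|a l|) => l.
  have [al|/ltW al] := leP 1 `|a l|; last by rewrite ler_wpDr// sumr_ge0.
  rewrite (big_rem l)/=; last by rewrite in_fset_set// inE.
  by rewrite addrCA lerDl addr_ge0// sumr_ge0.
- by split => [/supE H|[/supE H _]]; [split => //; exact: H|exact: H].
- by split => [/l1E H|[/l1E H _]]; [split => //; exact: H|exact: H].
Qed.

Lemma psum_le_norm a s : family_space a -> test s -> psum s a <= family_norm a.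
Proof.
move=> /[dup] Ea /family_spaceP[[M aM] _] ts.
have M0 := psum_bounded_ge0 aM.
have sup_case : E <> l1_sum -> psum s a <= sup (range (fun l => `|a l|)).
  move=> El1.
  have Mub : ubound (range (fun l => `|a l|)) M.
    by move=> _ [l _ <-]; rewrite -psum1; apply: aM; exact: test1.
  case: s ts => [_|l [|l' s]]; last by rewrite /test; case: E El1.
    rewrite /psum big_nil; have [->|/set0P[_ [l _ _]]] :=
      eqVneq (range (fun l => `|a l|)) set0; first by rewrite sup0.
    apply: (@le_trans _ _ `|a l|) => //; apply: ub_le_sup; first by exists M.
    by exists l.
  by rewrite psum1 => _; apply: ub_le_sup; [exists M|exists l].
have l1_case : E = l1_sum ->
    psum s a <= fine (\esum_(l in [set: L]) (`|a l|)%:E).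
  move=> El1; rewrite -lee_fin fineK; first exact: psum_le_esum.
  rewrite ge0_fin_numE ?esum_ge0//.
  by apply: (le_lt_trans (esum_le_psum El1 aM)); exact: ltry.
by rewrite /family_norm; case: E sup_case l1_case => h h'; [exact: h|exact: h|exact: h'].
Qed.

Lemma norm_le_psum a M : psum_bounded a M -> family_norm a <= M.
Proof.
move=> aM; have M0 := psum_bounded_ge0 aM.
have sup_case : E <> l1_sum -> sup (range (fun l => `|a l|)) <= M.
  move=> El1; have [->|/set0P ne] :=
    eqVneq (range (fun l => `|a l|)) set0; first by rewrite sup0.
  apply: ge_sup => // _ [l _ <-].
  by rewrite -psum1; apply: aM; exact: test1.
have l1_case : E = l1_sum ->
    fine (\esum_(l in [set: L]) (`|a l|)%:E) <= M.
  move=> El1; have h := esum_le_psum El1 aM.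
  rewrite -lee_fin fineK// ge0_fin_numE ?esum_ge0//.
  by apply: (le_lt_trans h); exact: ltry.
by rewrite /family_norm; case: E sup_case l1_case => h h'; [exact: h|exact: h|exact: h'].
Qed.

Lemma psum_mono s a b : (forall l, `|a l| <= `|b l|) -> psum s a <= psum s b.
Proof. by move=> ab; apply: ler_sum. Qed.

Lemma psumD s a b : psum s (a \+ b) <= psum s a + psum s b.
Proof. by rewrite /psum -big_split/=; apply: ler_sum => l _; exact: ler_normD. Qed.

Lemma psumZ s r a : psum s (r \*o a) = `|r| * psum s a.
Proof. by rewrite /psum mulr_sumr; apply: eq_bigr => l _; rewrite normrM. Qed.

Lemma vanishing_mono a b :
  (forall l, `|a l| <= `|b l|) -> vanishing b -> vanishing a.
Proof.
rewrite /vanishing; case: E => // ab vb e e0.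
by apply: sub_finite_set (vb e e0) => l /= /le_trans; apply.
Qed.

Lemma vanishingD a b : vanishing a -> vanishing b -> vanishing (a \+ b).
Proof.
rewrite /vanishing; case: E => // va vb e e0.
have e20 : 0 < e / 2 by rewrite divr_gt0.
have : finite_set ([set l | e / 2 <= `|a l|] `|` [set l | e / 2 <= `|b l|]).
  by rewrite finite_setU; split; [exact: va|exact: vb].
apply: sub_finite_set => l /= eab.
have [?|ae] := leP (e / 2) `|a l|; first by left.
have [?|be] := leP (e / 2) `|b l|; first by right.
have h : `|a l| + `|b l| < e by rewrite [ltRHS]splitr ltrD.
by move: (le_trans eab (ler_normD _ _)); rewrite leNgt h.
Qed.

Lemma family_space_mono a b : (forall l, `|a l| <= `|b l|) ->
  family_space b -> family_space a.
Proof.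
move=> ab /family_spaceP[[M bM] vb]; apply/family_spaceP; split.
  by exists M => s ts; apply: le_trans (bM s ts); exact: psum_mono.
exact: vanishing_mono vb.
Qed.

Lemma family_norm_mono a b : (forall l, `|a l| <= `|b l|) ->
  family_space b -> family_norm a <= family_norm b.
Proof.
move=> ab Eb; apply: norm_le_psum => s ts.
by apply: le_trans (psum_le_norm Eb ts); exact: psum_mono.
Qed.

Lemma family_spaceD a b : family_space a -> family_space b ->
  family_space (a \+ b).
Proof.
move=> /family_spaceP[[M aM] va] /family_spaceP[[N bN] vb].
apply/family_spaceP; split; last exact: vanishingD.
exists (M + N) => s ts; apply: le_trans (psumD _ _ _) _.
by rewrite lerD ?aM ?bN.
Qed.

Lemma family_normD a b : family_space a -> family_space b ->
  family_norm (a \+ b) <= family_norm a + family_norm b.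
Proof.
move=> Ea Eb; apply: norm_le_psum => s ts; apply: le_trans (psumD _ _ _) _.
by rewrite lerD ?psum_le_norm.
Qed.

Lemma family_spaceZ r a : family_space a -> family_space (r \*o a).
Proof.
move=> /family_spaceP[[M aM] va]; apply/family_spaceP; split.
  by exists (`|r| * M) => s ts; rewrite psumZ ler_wpM2l ?aM.
have [->|r0] := eqVneq r 0.
  move: va; rewrite /vanishing; case: E => // _ e e0.
  rewrite (_ : [set _ | _] = set0)//; apply/seteqP; split => // l /=.
  by rewrite mul0r normr0 leNgt e0.
move: va; rewrite /vanishing; case: E => // va e e0.
have : finite_set [set l | e / `|r| <= `|a l|].
  by apply: va; rewrite divr_gt0 ?normr_gt0.
apply: sub_finite_set => l /=.
by rewrite normrM ler_pdivrMr ?normr_gt0// mulrC.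
Qed.

Lemma family_norm_ge0 a : family_space a -> 0 <= family_norm a.
Proof. by move=> Ea; have := psum_le_norm Ea test0; rewrite /psum big_nil. Qed.

Lemma family_normZ r a : family_space a ->
  family_norm (r \*o a) = `|r| * family_norm a.
Proof.
have le t c : family_space c ->
    family_norm (t \*o c) <= `|t| * family_norm c.
  move=> Ec; apply: norm_le_psum => s ts; rewrite psumZ.
  by rewrite ler_wpM2l ?psum_le_norm.
move=> Ea; apply/eqP; rewrite eq_le le//=.
have [->|r0] := eqVneq r 0.
  by rewrite normr0 mul0r family_norm_ge0//; exact: family_spaceZ.
have {1}-> : a = r^-1 \*o (r \*o a).
  by apply/funext => l /=; rewrite mulrA mulVf// mul1r.
rewrite -ler_pdivlMl ?normr_gt0// -normfV.
by apply: le; exact: family_spaceZ.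
Qed.

Lemma family_norm_coord a l : family_space a -> `|a l| <= family_norm a.
Proof. by move=> Ea; rewrite -psum1; apply: psum_le_norm => //; exact: test1. Qed.

Lemma family_space0 : family_space (fun=> 0).
Proof.
apply/family_spaceP; split.
  by exists 0 => s _; rewrite /psum big1// => l _; rewrite normr0.
rewrite /vanishing; case: E => // e e0.
rewrite (_ : [set _ | _] = set0)//; apply/seteqP; split => // l /=.
by rewrite normr0 leNgt e0.
Qed.

(* c is approximated on finite sets by families of norm at most e. *)
Definition finitely_approx (e : R) c : Prop :=
  forall s, test s -> forall d : R, 0 < d -> exists b,
    [/\ family_space b, family_norm b <= e & forall l, l \in s ->
        `|c l| <= `|b l| + d].

Lemma finitely_approx_bounded e c : finitely_approx e c -> psum_bounded c e.
Proof.
move=> ec s ts; apply/ler_addgt0Pr => d d0.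
have d'0 : 0 < d / (1 + (size s)%:R) by rewrite divr_gt0// ltr_pwDl.
have [b [Eb be cb]] := ec s ts _ d'0.
apply: (@le_trans _ _ (\sum_(l <- s) (`|b l| + d / (1 + (size s)%:R)))).
  by rewrite /psum !big_seq; apply: ler_sum => l ls; exact: cb.
rewrite big_split/= lerD//; first by apply: le_trans be; exact: psum_le_norm.
rewrite big_const_seq count_predT iter_addr_0 -(mulr_natr (d / _)).
by rewrite mulrAC ler_pdivrMr ?ltr_pwDl// ler_pM2l// lerDr.
Qed.

Lemma family_space_closed a :
  (forall e : R, 0 < e -> exists b c, [/\ family_space b, finitely_approx e c
     & forall l, `|a l| <= `|b l + c l|]) -> family_space a.
Proof.
move=> H; apply/family_spaceP; split.
  have [b [c [Eb c1 abc]]] := H 1 ltr01.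
  have [[M bM] _] := (family_spaceP b).1 Eb.
  exists (M + 1) => s ts; apply: le_trans (psum_mono s abc) _.
  apply: le_trans (psumD _ _ _) _.
  by rewrite lerD ?bM// finitely_approx_bounded.
suff : E = c0_sum -> vanishing a by rewrite /vanishing; case: E => //; apply.
move=> Ec0; rewrite /vanishing Ec0 => e e0.
have e20 : 0 < e / 2 by rewrite divr_gt0.
have [b [c [Eb ce abc]]] := H (e / 2 / 2) (divr_gt0 e20 (ltr0Sn _ 1)).
have [_] := (family_spaceP b).1 Eb; rewrite /vanishing Ec0 => /(_ _ e20).
apply: sub_finite_set => l /= /le_trans /(_ (abc l)) ebc.
have cl : `|c l| <= e / 2.
  apply: (@le_trans _ _ (e / 2 / 2)).
    by rewrite -psum1; apply: finitely_approx_bounded => //; exact: test1.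
  by rewrite ler_pdivrMr// ler_peMr ?(ltW e20)// ler1n.
rewrite -(lerD2r (e / 2)) -splitr; apply: le_trans ebc _.
by apply: le_trans (ler_normD _ _) _; rewrite lerD2l.
Qed.

End FamilySpaces.

Record direct_sum (R : realType) (s : scalar_kind) (E : sum_kind)
    (L : choiceType) (X : L -> completeNormedModType (scalars R s)) :=
  DirectSum {
    component :> forall l, X l ;
    component_space : family_space E (fun l => rnorm (component l)) }.

Section DirectSum.
Variables (R : realType) (s : scalar_kind) (E : sum_kind) (L : choiceType).
Local Notation K := (scalars R s).
Variable X : L -> completeNormedModType K.
Local Notation V := (direct_sum E X).

HB.instance Definition _ := gen_eqMixin V.
HB.instance Definition _ := gen_choiceMixin V.

Lemma direct_sum_ext (x y : V) : (forall l, x l = y l) -> x = y.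
Proof.
case: x y => [x Ex] [y Ey] /= xy.
have {}xy : x = y by apply: functional_extensionality_dep.
by subst y; congr DirectSum; exact: Prop_irrelevance.
Qed.

Lemma family_space_rnorm (x y z : forall l, X l) :
  (forall l, rnorm (x l) <= rnorm (y l) + rnorm (z l)) ->
  family_space E (fun l => rnorm (y l)) ->
  family_space E (fun l => rnorm (z l)) -> family_space E (fun l => rnorm (x l)).
Proof.
move=> xyz Ey Ez; apply: family_space_mono (family_spaceD Ey Ez) => l /=.
by rewrite !ger0_norm ?addr_ge0 ?rnorm_ge0.
Qed.

Lemma direct_sum0_subproof : family_space E (fun l => rnorm (0 : X l)).
Proof.
by apply: family_space_mono (family_space0 _ _ _) => l; rewrite rnorm0.
Qed.

Lemma direct_sumD_subproof (x y : V) :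
  family_space E (fun l => rnorm (x l + y l)).
Proof.
apply: (@family_space_rnorm (fun l => x l + y l) x y); last 2 first.
- exact: component_space.
- exact: component_space.
by move=> l; exact: rnormD.
Qed.

Lemma direct_sumN_subproof (x : V) : family_space E (fun l => rnorm (- x l)).
Proof.
apply: family_space_mono (component_space x) => l.
by rewrite rnormN.
Qed.

Lemma direct_sumZ_subproof (c : K) (x : V) :
  family_space E (fun l => rnorm (c *: x l)).
Proof.
apply: family_space_mono
  (family_spaceZ (rnorm (c : K^o)) (component_space x)) => l /=.
by rewrite rnormZ.
Qed.

Definition direct_sum0 : V := DirectSum direct_sum0_subproof.
Definition direct_sumD (x y : V) : V := DirectSum (direct_sumD_subproof x y).
Definition direct_sumN (x : V) : V := DirectSum (direct_sumN_subproof x).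
Definition direct_sumZ (c : K) (x : V) : V :=
  DirectSum (direct_sumZ_subproof c x).

Lemma direct_sumDA : associative direct_sumD.
Proof. by move=> x y z; apply: direct_sum_ext => l /=; rewrite addrA. Qed.
Lemma direct_sumDC : commutative direct_sumD.
Proof. by move=> x y; apply: direct_sum_ext => l /=; rewrite addrC. Qed.
Lemma direct_sum0D : left_id direct_sum0 direct_sumD.
Proof. by move=> x; apply: direct_sum_ext => l /=; rewrite add0r. Qed.
Lemma direct_sumND : left_inverse direct_sum0 direct_sumN direct_sumD.
Proof. by move=> x; apply: direct_sum_ext => l /=; rewrite addNr. Qed.

HB.instance Definition _ := GRing.isZmodule.Build V
  direct_sumDA direct_sumDC direct_sum0D direct_sumND.

Lemma direct_sumZA c d (x : V) :
  direct_sumZ c (direct_sumZ d x) = direct_sumZ (c * d) x.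
Proof. by apply: direct_sum_ext => l /=; rewrite scalerA. Qed.
Lemma direct_sum1Z : left_id 1 direct_sumZ.
Proof. by move=> x; apply: direct_sum_ext => l /=; rewrite scale1r. Qed.
Lemma direct_sumZDr : right_distributive direct_sumZ +%R.
Proof. by move=> c x y; apply: direct_sum_ext => l /=; rewrite scalerDr. Qed.
Lemma direct_sumZDl (x : V) :
  {morph direct_sumZ^~ x : c d / c + d}.
Proof. by move=> c d; apply: direct_sum_ext => l /=; rewrite scalerDl. Qed.

HB.instance Definition _ := GRing.Zmodule_isLmodule.Build K V
  direct_sumZA direct_sum1Z direct_sumZDr direct_sumZDl.

Definition direct_sum_norm (x : V) : R := family_norm E (fun l => rnorm (x l)).

Lemma direct_sum_norm_ge0 x : 0 <= direct_sum_norm x.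
Proof. by apply: family_norm_ge0; exact: component_space. Qed.

Lemma direct_sum_normD x y :
  direct_sum_norm (x + y) <= direct_sum_norm x + direct_sum_norm y.
Proof.
have Ex := component_space x; have Ey := component_space y.
apply: le_trans (family_normD Ex Ey).
apply: family_norm_mono (family_spaceD Ex Ey) => l /=.
by rewrite !ger0_norm ?addr_ge0 ?rnorm_ge0// rnormD.
Qed.

Lemma direct_sum_normZ (c : K) x :
  direct_sum_norm (c *: x) = rnorm (c : K^o) * direct_sum_norm x.
Proof.
rewrite -(ger0_norm (rnorm_ge0 (c : K^o))).
rewrite -(family_normZ _ (component_space x)); congr family_norm.
by apply/funext => l /=; rewrite rnormZ.
Qed.

Lemma direct_sum_norm_component (x : V) l : rnorm (x l) <= direct_sum_norm x.
Proof.
rewrite -[leLHS]ger0_norm ?rnorm_ge0//.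
exact: (family_norm_coord l (component_space x)).
Qed.

Let norm (x : V) : K := of_real s (direct_sum_norm x).

Let normD x y : norm (x + y) <= norm x + norm y.
Proof. by rewrite -of_realD ler_of_real direct_sum_normD. Qed.

Let normZ (c : K) (x : V) : norm (c *: x) = `|c| * norm x.
Proof. by rewrite /norm direct_sum_normZ of_realM of_rnorm. Qed.

Let norm_eq0 (x : V) : norm x = 0 -> x = 0.
Proof.
move=> /(congr1 (@realpart R s)); rewrite of_realK -(of_real0 R s) of_realK => x0.
apply: direct_sum_ext => l /=; apply: rnorm_eq0; apply/eqP.
by rewrite eq_le rnorm_ge0 andbT -x0 direct_sum_norm_component.
Qed.

HB.instance Definition _ := Lmodule_isNormed.Build K V normD normZ norm_eq0.

Lemma rnorm_direct_sum (x : V) :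
  rnorm x = family_norm E (fun l => rnorm (x l)).
Proof. exact: of_realK. Qed.

Lemma rnorm_component (x : V) l : rnorm (x l) <= rnorm x.
Proof. by rewrite rnorm_direct_sum; exact: direct_sum_norm_component. Qed.

Lemma direct_sum_complete (F : set_system V) :
  ProperFilter F -> cauchy F -> cvg F.
Proof.
move=> FF Fc.
have Fe (e : R) : 0 < e ->
    exists2 A, F A & forall x y, A x -> A y -> rnorm (x - y) <= e.
  move=> e0; have /cauchy_ballP /(_ (of_real s e)) := Fc.
  rewrite -(of_real0 R s) ltr_of_real => /(_ e0) [[A B] /= [FA FB] AB].
  exists (A `&` B) => [|x y [Ax _] [_ By]]; first exact: filterI.
  have := AB (x, y) (conj Ax By); rewrite /= -ball_normE /= => /ltW.
  by rewrite -of_rnorm ler_of_real.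
have Fl l : cvg ((fun x : V => x l) @ F).
  apply: cauchy_cvg; apply/cauchy_ballP => e e0.
  have eE : e = of_real s (realpart e) by rewrite realpartK// ltW.
  have e0' : 0 < realpart e by rewrite -(@ltr_of_real _ s) -eE of_real0.
  have [A FA Ae] := Fe (realpart e / 2) (divr_gt0 e0' (ltr0Sn _ 1)).
  exists ((fun x : V => x l) @` A, (fun x : V => x l) @` A).
    by split; apply: (@filterS _ F _ A) => // x Ax; exists x.
  move=> [_ _] [[x Ax <-] [y Ay <-]] /=; rewrite -ball_normE /=.
  rewrite -of_rnorm eE ltr_of_real.
  apply: (@le_lt_trans _ _ (realpart e / 2)); last first.
    by rewrite ltr_pdivrMr// ltr_pMr// ltr1n.
  apply: le_trans (Ae _ _ Ax Ay); rewrite rnorm_direct_sum.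
  exact: (direct_sum_norm_component (x - y) l).
pose z l : X l := lim ((fun x : V => x l) @ F).
have approx (e : R) (A : set V) x : F A -> A x ->
    (forall x y, A x -> A y -> rnorm (x - y) <= e) ->
    finitely_approx E e (fun l => rnorm (z l - x l)).
  move=> FA Ax Ae t _ d d0.
  have : F [set y : V | forall l, l \in t -> rnorm (z l - y l) <= d].
    elim: t => [|l t IH]; first exact: (@filterS _ F _ setT) _ filterT.
    have dK : 0 < of_real s d by rewrite -(of_real0 R s) ltr_of_real.
    have /cvgrPdist_le /(_ _ dK) Hl := Fl l.
    apply: filterS2 IH Hl => y yt yl m; rewrite inE => /predU1P[->|/yt//].
    by rewrite -(@ler_of_real _ s) of_rnorm.
  move=> /(filterI FA) /filter_ex [y [Ay yt]].
  exists (fun l => rnorm ((y - x) l)); split.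
  - exact: component_space.
  - by rewrite -rnorm_direct_sum; exact: Ae.
  move=> l /yt yl; rewrite !ger0_norm ?rnorm_ge0//.
  have -> : z l - x l = (y l - x l) + (z l - y l).
    by rewrite [RHS]addrC addrA subrK.
  by apply: le_trans (rnormD _ _) _; rewrite lerD2l.
have Ez : family_space E (fun l => rnorm (z l)).
  apply: family_space_closed => e e0; have [A FA Ae] := Fe e e0.
  have [x Ax] := filter_ex FA.
  exists (fun l => rnorm (x l)), (fun l => rnorm (z l - x l)); split.
  - exact: component_space.
  - exact: approx FA Ax Ae.
  move=> l; rewrite !ger0_norm ?addr_ge0 ?rnorm_ge0//.
  by rewrite -{1}(subrK (x l) (z l)) addrC; exact: rnormD.
apply/cvg_ex; exists (DirectSum Ez); apply/cvgrPdist_le => e e0.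
have eE : e = of_real s (realpart e) by rewrite realpartK// ltW.
have e0' : 0 < realpart e by rewrite -(@ltr_of_real _ s) -eE of_real0.
have [A FA Ae] := Fe _ e0'.
apply: (@filterS _ F _ A) => // x Ax; rewrite -of_rnorm eE ler_of_real rnorm_direct_sum.
apply: norm_le_psum; apply: finitely_approx_bounded.
exact: approx FA Ax Ae.
Qed.

HB.instance Definition _ := Uniform_isComplete.Build V direct_sum_complete.

End DirectSum.

Section Diagonal.
Variables (R : realType) (s : scalar_kind) (E : sum_kind) (L : choiceType).
Local Notation K := (scalars R s).
Variables X Y : L -> completeNormedModType K.
Variables (k : nat) (Q : forall l, hpoly k (X l) (Y l)).
Hypothesis k0 : (0 < k)%N.
Hypothesis Q1 : forall l, ball_norm (Q l) = 1%E.

Lemma hpoly1_le l (u : X l) : rnorm u <= 1 -> rnorm (Q l u) <= 1.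
Proof.
move=> u1; rewrite -lee_fin -(Q1 l); apply: ereal_sup_ubound.
by exists u.
Qed.

Lemma hpoly1_leX l (u : X l) : rnorm (Q l u) <= rnorm u ^+ k.
Proof.
have [w w1 {1}->] := rnorm_normalize u.
rewrite (homogeneous_scale _ _ (hpoly_homogeneous (Q l))).
have -> : of_real s (rnorm u) ^+ k = of_real s (rnorm u ^+ k) :> K.
  by elim: k => [|m IH]; rewrite ?of_real1// !exprS of_realM IH.
rewrite rnormZr ger0_norm ?exprn_ge0 ?rnorm_ge0// ler_piMr//.
  by rewrite exprn_ge0 ?rnorm_ge0.
exact: hpoly1_le.
Qed.

Lemma diagonal_le (x : direct_sum E X) l :
  rnorm (Q l (x l)) <= rnorm x ^+ k.-1 * rnorm (x l).
Proof.
apply: le_trans (hpoly1_leX _) _.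
rewrite -{1}(prednK k0) exprSr ler_wpM2r ?rnorm_ge0//.
by rewrite lerXn2r ?nnegrE ?rnorm_ge0// rnorm_component.
Qed.

Lemma diagonal_space (x : direct_sum E X) :
  family_space E (fun l => rnorm (Q l (x l))).
Proof.
apply: family_space_mono (family_spaceZ (rnorm x ^+ k.-1) (component_space x)).
move=> l /=; rewrite !ger0_norm ?mulr_ge0 ?exprn_ge0 ?rnorm_ge0//.
exact: diagonal_le.
Qed.

Definition diagonal (x : direct_sum E X) : direct_sum E Y :=
  DirectSum (diagonal_space x).

Lemma rnorm_diagonal_le (x : direct_sum E X) :
  rnorm (diagonal x) <= rnorm x ^+ k.
Proof.
rewrite -{1}(prednK k0) exprSr [X in _ <= _ * X]rnorm_direct_sum.
rewrite -[X in X * _]ger0_norm ?exprn_ge0 ?rnorm_ge0//.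
rewrite -(family_normZ _ (component_space x)) rnorm_direct_sum.
apply: family_norm_mono; last exact: family_spaceZ (component_space x).
move=> l /=; rewrite !ger0_norm ?mulr_ge0 ?exprn_ge0 ?rnorm_ge0//.
exact: diagonal_le.
Qed.

Lemma component_sum (Z : L -> completeNormedModType K) (I : finType)
    (F : I -> direct_sum E Z) l : (\sum_i F i) l = \sum_i F i l.
Proof. by elim/big_ind2: _ => // x1 x2 y1 y2 <- <-. Qed.

Lemma polar_diagonal (v : 'I_k -> direct_sum E X) l : polar diagonal v l = polar (Q l) (fun i => v i l).
Proof.
rewrite /polar; congr (_ *: _); rewrite component_sum.
apply: eq_bigr => T _; congr (_ *: Q l _); rewrite component_sum.
by apply: eq_bigr => j _; case: ifP.
Qed.

Lemma diagonal_homogeneous : homogeneous k diagonal.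
Proof.
exists (polar diagonal); last first.
  move=> x; apply: direct_sum_ext => l; rewrite polar_diagonal/=.
  by rewrite polar_diag//; exact: hpoly_homogeneous.
move=> i v c x y; apply: direct_sum_ext => l.
have dE w : (fun j => dfwith v i w j l) = dfwith (fun j => v j l) i (w l).
  apply/funext => j; have [<-|ij] := eqVneq i j; first by rewrite !dfwithin.
  by rewrite !dfwithout.
transitivity (c *: polar diagonal (dfwith v i x) l
              + polar diagonal (dfwith v i y) l) => //.
rewrite !polar_diagonal !dE.
exact: (polar_multilinear (hpoly_homogeneous (Q l))).
Qed.

Lemma diagonal_continuous : continuous diagonal.
Proof.
apply: (homogeneous_bounded_continuous (M := 1) diagonal_homogeneous) => x x1.
apply: le_trans (rnorm_diagonal_le _) _.
by rewrite exprn_ile1 ?rnorm_ge0.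
Qed.

Definition diagonal_hpoly : hpoly k (direct_sum E X) (direct_sum E Y) :=
  HPoly diagonal_homogeneous diagonal_continuous.

End Diagonal.

Arguments diagonal_hpoly {R s} E {L X Y k Q} k0 Q1.

Section DiagonalNorm.
Variables (R : realType) (s : scalar_kind) (E : sum_kind) (L : choiceType).
Local Notation K := (scalars R s).
Variables X Y : L -> completeNormedModType K.

Definition single (Z : L -> completeNormedModType K) l (u : Z l) :
  forall m, Z m := dfwith (fun m => 0) l u.

Lemma psum_single (Z : L -> completeNormedModType K) l (u : Z l) :
  psum_bounded E (fun m => rnorm (single u m)) (rnorm u).
Proof.
move=> t tt.
have ut : uniq t by move: tt; rewrite /test; case: E; case: t => [|? []].
have z m : m != l -> `|rnorm (single u m)| = 0.
  by move=> ml; rewrite /single dfwithout 1?eq_sym// rnorm0 normr0.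
have [lt|lt] := boolP (l \in t).
  rewrite /psum (bigD1_seq l)//= big1 ?addr0 => [|m /z//].
  by rewrite /single dfwithin ger0_norm ?rnorm_ge0.
rewrite /psum big_seq big1 ?rnorm_ge0// => m mt; apply: z.
by apply: contra lt => /eqP <-.
Qed.

Lemma single_space (Z : L -> completeNormedModType K) l (u : Z l) :
  family_space E (fun m => rnorm (single u m)).
Proof.
apply/family_spaceP; split; first by exists (rnorm u); exact: psum_single.
rewrite /vanishing; case: E => // e e0.
apply: (@sub_finite_set _ _ [set l]); last exact: finite_set1.
move=> m /=; have [//|ml] := eqVneq m l.
by rewrite /single dfwithout 1?eq_sym// rnorm0 normr0 leNgt e0.
Qed.

Variables (k : nat) (Q : forall l, hpoly k (X l) (Y l)).
Hypothesis k0 : (0 < k)%N.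
Hypothesis Q1 : forall l, ball_norm (Q l) = 1%E.

(* l witnesses that the index set is nonempty. *)
Lemma diagonal_hpoly_norm1 (l : L) : ball_norm (diagonal_hpoly E k0 Q1) = 1%E.
Proof.
apply/eqP; rewrite eq_le; apply/andP; split.
  apply: ge_ereal_sup => _ [x /= x1 <-]; rewrite lee_fin.
  apply: le_trans (rnorm_diagonal_le _ _ _) _.
  by rewrite exprn_ile1 ?rnorm_ge0.
rewrite -(Q1 l); apply: ge_ereal_sup => _ [u /= u1 <-].
pose x : direct_sum E X := DirectSum (single_space u).
apply: (@le_trans _ _ (rnorm (diagonal_hpoly E k0 Q1 x))%:E).
  rewrite lee_fin; apply: le_trans (rnorm_component _ l).
  by rewrite /= /single dfwithin.
apply: ereal_sup_ubound; exists x => //=.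
by rewrite rnorm_direct_sum; apply: le_trans u1; apply/norm_le_psum/psum_single.
Qed.

End DiagonalNorm.

(* Main.v *)
Require Import Defs.
From HB Require Import structures.
From mathcomp Require Import all_boot all_order all_algebra complex ring lra.
From mathcomp Require Import all_classical all_reals all_analysis.

(** Fix an index [l] and a norm-one polynomial [P : X l -> Y l].  Applying [P]
to the [l]-th coordinate and injecting the result into the sum gives a norm-one
polynomial [P'] on the sums, and the whole point is that its numerical radius
with respect to the diagonal polynomial [Q] is at most that of [P] with respect
to [Q l] ([numerical_radius_localization]); the infimum defining the index of
[Q] is then below the one defining the index of [Q l].

Let [t] lie in the numerical range of [P'], witnessed up to [d] by a norm-one
functional [f] and a unit vector [x] with [Re f (Q x) > 1 - d], and let [g] be
the restriction of [f] to the [l]-th summand.  If the [l]-th coordinate of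
[Q x] is replaced by any vector of norm at most [rnorm (x l) ^+ k], the result
still has norm at most 1, because each coordinate is dominated by that of [x]
and all three sum norms are monotone.  Testing [f] on such vectors gives
[||g|| * rnorm (x l) ^+ k <= Re g (Q l (x l)) + d]
([restriction_almost_normed]).  So, when [t] is nonzero and [d] is small with
respect to it, normalizing both [g] and [x l] yields a pair which almost norms
[Q l], and at which [P] takes a value of modulus at least [rnorm t - d]
([approx_numerical_range_normalize]).

Discs of the scalar field are compact, so values of the approximate ranges with
modulus at least [rnorm t - e], for all [e > 0], accumulate at a point of the
numerical range of modulus at least [rnorm t] ([numerical_radius_ge]).

The case [t = 0] is of a different nature: [f] may vanish on the [l]-th summand,
and one has to know that the numerical range of [P] is not empty.  This needs
functionals on [Y l] that norm given vectors, hence the Hahn-Banach theorem,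
which is established by taking a minimal sublinear functional. *)

Set Implicit Arguments.
Unset Strict Implicit.
Unset Printing Implicit Defensive.

Import Order.TTheory GRing.Theory Num.Theory.
Import numFieldNormedType.Exports.

Local Open Scope classical_set_scope.
Local Open Scope ring_scope.

(** * The Hahn-Banach theorem *)

Section HahnBanach.
Variables (R : realType) (V : lmodType R).
Implicit Types (p q : V -> R) (x y z : V).

Definition sublinear q : Prop :=
  (forall x y, q (x + y) <= q x + q y) /\
  (forall (c : R) x, 0 <= c -> q (c *: x) <= c * q x).

Lemma sublinear0 q : sublinear q -> q 0 = 0.
Proof.
move=> [qD qZ]; apply/eqP; rewrite eq_le; apply/andP; split.
  by have := qZ 0 0 (lexx _); rewrite scale0r mul0r.
by have := qD 0 0; rewrite addr0 -lerBlDr subrr.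
Qed.

Lemma sublinearZ q (c : R) x : sublinear q -> 0 <= c -> q (c *: x) = c * q x.
Proof.
move=> /[dup] sq [_ qZ]; rewrite le_eqVlt => /predU1P[<-|c0].
  by rewrite scale0r mul0r sublinear0.
apply/eqP; rewrite eq_le (qZ _ _ (ltW c0))/= -ler_pdivlMl//.
have := qZ c^-1 (c *: x); rewrite scalerA mulVf ?gt_eqF// scale1r; apply.
by rewrite invr_ge0 ltW.
Qed.

Lemma sublinear_geN q x : sublinear q -> - q (- x) <= q x.
Proof.
move=> /[dup] sq [qD _]; rewrite -subr_ge0 opprK -(sublinear0 sq) -(subrr x).
exact: qD.
Qed.

(** The member bounding a sum may depend on the members chosen at the two terms.
This freedom covers both a chain, where it is the smaller of the two, and the
translates of a functional along a half-line, where it is their sum. *)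
Lemma sublinear_inf (I : Type) (D : set I) (F : I -> V -> R) (m : V -> R) :
    D !=set0 ->
    (forall i x, D i -> m x <= F i x) ->
    (forall i j x y, D i -> D j ->
      exists2 l, D l & F l (x + y) <= F i x + F j y) ->
    (forall i (c : R) x, D i -> 0 <= c ->
      exists2 l, D l & F l (c *: x) <= c * F i x) ->
  sublinear (fun x => inf [set F i x | i in D]).
Proof.
move=> [i0 Di0] mF FD FZ.
have lbF x : has_lbound [set F i x | i in D].
  by exists (m x) => _ [i Di <-]; exact: mF.
have neF x : [set F i x | i in D] !=set0 by exists (F i0 x), i0.
split=> [x y|c x]; last first.
  rewrite le_eqVlt => /predU1P[<-|c0].
    have [l Dl] := FZ i0 0 x Di0 (lexx _).
    rewrite !mul0r; apply: le_trans; apply: ge_inf => //.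
    by exists l.
  rewrite -ler_pdivrMl//; apply: lb_le_inf => // _ [i Di <-].
  rewrite ler_pdivrMl//; have [l Dl] := FZ i c x Di (ltW c0).
  by apply: le_trans; apply: ge_inf => //; exists l.
rewrite -lerBlDr; apply: lb_le_inf => // _ [i Di <-].
rewrite lerBlDr -lerBlDl; apply: lb_le_inf => // _ [j Dj <-].
rewrite lerBlDl; have [l Dl] := FD i j x y Di Dj.
by apply: le_trans; apply: ge_inf => //; exists l.
Qed.

(** The functional [x |-> inf_(t >= 0) (q (x + t *: z) - t * q z)].  If [q] is
minimal it must coincide with [q], and the bound obtained at [t = 1] then says
that [q] is superadditive. *)
Lemma sublinear_descend q z : sublinear q ->
  exists q', [/\ sublinear q', forall x, q' x <= q x &
                 forall x, q' x <= q (x + z) - q z].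
Proof.
move=> /[dup] sq [qD _].
pose F (t : R) x := q (x + t *: z) - t * q z.
have mF t x : [set t : R | 0 <= t] t -> - q (- x) <= F t x.
  move=> /= t0; rewrite /F -(sublinearZ _ sq t0) lerBrDr addrC lerBlDr addrC.
  by apply: le_trans (qD _ _); rewrite addKr.
exists (fun x => inf [set F t x | t in [set t : R | 0 <= t]]); split.
- apply: (sublinear_inf (m := fun x => - q (- x))) mF _ _.
  + by exists 0 => /=.
  + move=> t u x y /= t0 u0; exists (t + u); first by rewrite /= addr_ge0.
    rewrite /F scalerDl addrACA.
    by have := qD (x + t *: z) (y + u *: z); lra.
  + move=> t c x /= t0 c0; exists (c * t); first by rewrite /= mulr_ge0.
    by rewrite /F -scalerA -scalerDr (sublinearZ _ sq c0) mulrBr mulrA.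
- move=> x; apply: ge_inf; first by exists (- q (- x)) => _ [t /mF ? <-].
  by exists 0 => //=; rewrite /F scale0r mul0r addr0 subr0.
- move=> x; apply: ge_inf; first by exists (- q (- x)) => _ [t /mF ? <-].
  by exists 1 => //=; rewrite /F scale1r mul1r.
Qed.

(** Zorn's lemma applies because the members of a chain below [p] are bounded
below pointwise by [x |-> - p (- x)], so that their infimum is finite. *)
Lemma sublinear_minimal p : sublinear p ->
  exists q, [/\ sublinear q, forall x, q x <= p x & forall q', sublinear q' ->
    (forall x, q' x <= q x) -> forall x, q' x = q x].
Proof.
move=> sp.
pose T := {q | sublinear q /\ forall x, q x <= p x}.
pose below (q1 q2 : T) := `[< forall x, sval q2 x <= sval q1 x >].
have [||||[q [sq qp]] qmin] := @Zorn T below.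
- by move=> q; apply/asboolP.
- move=> q1 q2 q3 /asboolP q21 /asboolP q32; apply/asboolP => x.
  exact: le_trans (q32 x) (q21 x).
- move=> [q1 P1] [q2 P2] /asboolP q21 /asboolP q12; apply: eq_exist.
  by apply/funext => x; apply/eqP; rewrite eq_le q12 q21.
- move=> A Atot; have [->|/set0P[q0 Aq0]] := eqVneq A set0.
    by exists (exist _ p (conj sp (fun x => lexx _))).
  have mA (q : T) x : A q -> - p (- x) <= sval q x.
    case: q => q [sq qp] _ /=; apply: le_trans (sublinear_geN x sq).
    by rewrite lerN2.
  pose q x := inf [set sval a x | a in A].
  have lbA x : has_lbound [set sval a x | a in A].
    by exists (- p (- x)) => _ [a /mA ? <-].
  have sq : sublinear q.
    apply: (sublinear_inf (m := fun x => - p (- x))) mA _ _.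
    + by exists q0.
    + move=> a b x y Aa Ab.
      have [/asboolP ab|/asboolP ba] := Atot _ _ Aa Ab.
      * exists b => //; case: b ab {Ab} => b [[bD _] _] /= ab.
        by apply: le_trans (bD _ _) _; rewrite lerD2r.
      * exists a => //; case: a ba {Aa} => a [[aD _] _] /= ba.
        by apply: le_trans (aD _ _) _; rewrite lerD2l.
    + move=> a c x Aa c0; exists a => //.
      by case: a {Aa} => a [[_ aZ] _] /=; exact: aZ.
  have qA (a : T) x : A a -> q x <= sval a x.
    by move=> Aa; apply: ge_inf => //; exists a.
  have qp x : q x <= p x.
    by apply: le_trans (qA _ x Aq0) _; case: (q0) => ? [].
  by exists (exist _ q (conj sq qp)) => a Aa; apply/asboolP => x /=; exact: qA.
exists q; split=> // q' sq' q'q.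
have q'p x : q' x <= p x by exact: le_trans (q'q x) (qp x).
suff /qmin/(congr1 sval)/= -> :
  below (exist _ q (conj sq qp)) (exist _ q' (conj sq' q'p)) by [].
exact/asboolP.
Qed.

(** Minimality below [p] gives linearity.  Minimality below the descent of [p]
along [z] moreover gives [f (- z) <= - p z], that is [p z <= f z]. *)
Theorem hahn_banach p z : sublinear p ->
  exists2 f : {scalar V}, (forall x, f x <= p x) & f z = p z.
Proof.
move=> sp; have [pz [spz pzp pzE]] := sublinear_descend z sp.
have [q [sq qpz qmin]] := sublinear_minimal spz.
have qD x y : q (x + y) = q x + q y.
  apply/eqP; rewrite eq_le sq.1/= -lerBrDr.
  by have [q' [sq' q'q q'E]] := sublinear_descend y sq; rewrite -(qmin q').
have qN x : q (- x) = - q x.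
  by apply/eqP; rewrite -addr_eq0 -qD addNr sublinear0.
have qlin : scalar q.
  move=> c x y; rewrite qD; congr (_ + _).
  have [c0|c0] := leP 0 c; first exact: sublinearZ.
  rewrite -[c]opprK scaleNr qN mulNr (sublinearZ x sq)//.
  by rewrite oppr_ge0 ltW.
pose qL := GRing.isLinear.Build R V R *%R q qlin.
pose f : {scalar V} := HB.pack q qL.
have qp x : q x <= p x by exact: le_trans (qpz x) (pzp x).
exists f => //=; apply/eqP; rewrite eq_le qp/= -lerN2 -qN.
apply: le_trans (qpz _) _; apply: le_trans (pzE _) _.
by rewrite addNr sublinear0// sub0r.
Qed.

End HahnBanach.

(** * Norming functionals over the real or complex scalars *)

Section Scalars.
Variables (R : realType) (s : scalar_kind).
Local Notation K := (scalars R s).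

Lemma of_realX (a : R) n : of_real s (a ^+ n) = of_real s a ^+ n :> K.
Proof.
by elim: n => [|n IH]; rewrite ?expr0 ?of_real1// !exprS of_realM IH.
Qed.

Lemma realpartD (z w : K) : realpart (z + w) = realpart z + realpart w.
Proof. by case: s z w => //= -[a b] [c d]. Qed.

Lemma realpartN (z : K) : realpart (- z) = - realpart z.
Proof. by case: s z => //= -[a b]. Qed.

Lemma realpart_scale (a : R) (z : K) :
  realpart (of_real s a * z) = a * realpart z.
Proof. by case: s z => //= -[b c] /=; rewrite mul0r subr0. Qed.

Lemma realpart_le_rnorm (z : K) : realpart z <= rnorm (z : K^o).
Proof.
rewrite /rnorm; case: s z => /= [z|z]; first exact: ler_norm.
by apply: le_trans (ler_norm _) _; rewrite -lecR; exact: normc_ge_Re.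
Qed.

Lemma rotation (z : K) :
  exists2 c : K, rnorm (c : K^o) = 1 & c * z = of_real s (rnorm (z : K^o)).
Proof.
have [->|z0] := eqVneq z 0.
  exists 1; last by rewrite mulr0 (@rnorm0 _ _ K^o) of_real0.
  by rewrite /rnorm normr1 -(@of_real1 R s) of_realK.
exists (`|z| / z); last by rewrite divfK// of_rnorm.
rewrite /rnorm normrM normfV normr_id mulfV ?normr_eq0//.
by rewrite -(@of_real1 R s) of_realK.
Qed.

End Scalars.

Section Functionals.
Variables (R : realType) (s : scalar_kind).
Local Notation K := (scalars R s).

Lemma le_ball_norm (X Y : normedModType K) (f : X -> Y) x : rnorm x <= 1 ->
  ((rnorm (f x))%:E <= ball_norm f)%E.
Proof. by move=> x1; apply: ereal_sup_ubound; exists x. Qed.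

Lemma ball_norm_le1 (X Y : normedModType K) (f : X -> Y) x :
  ball_norm f = 1%E -> rnorm x <= 1 -> rnorm (f x) <= 1.
Proof. by move=> f1 /(le_ball_norm f); rewrite f1 lee_fin. Qed.

Section Linear.
Variable Y : normedModType K.
Implicit Type f : {linear Y -> K^o}.

(** Rotating [y] by a scalar of modulus one makes [f y] real and nonnegative, so
bounds on real parts over the ball are bounds on moduli. *)
Lemma rnorm_functional_le f (M : R) (y : Y) :
  (forall u, rnorm u <= 1 -> realpart (f u) <= M) -> rnorm y <= 1 ->
  rnorm (f y) <= M.
Proof.
move=> fM y1; have [c c1 cE] := rotation (f y).
have /(congr1 (@realpart R s)) : f (c *: y) = of_real s (rnorm (f y)) :> K.
  by rewrite linearZ.
rewrite of_realK => <-; apply: fM.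
by rewrite rnormZ c1 mul1r.
Qed.

Lemma continuous_functional f (M : R) :
  (forall u, rnorm u <= 1 -> rnorm (f u) <= M) -> continuous f.
Proof.
apply: (@homogeneous_bounded_continuous _ _ 1%N).
exists (fun v => f (v ord0)) => // i v c x y.
by rewrite (ord1 i) !dfwithin linearP.
Qed.

Lemma ball_norm_scale f (a : R) : 0 < a -> ball_norm f = a%:E ->
  ball_norm (of_real s a^-1 \*: f) = 1%E.
Proof.
move=> a0 fa.
have E y : rnorm ((of_real s a^-1 \*: f) y) = a^-1 * rnorm (f y).
  by rewrite rnormZr ger0_norm// invr_ge0 ltW.
apply/eqP; rewrite eq_le; apply/andP; split.
  apply: ge_ereal_sup => _ [y /= y1 <-]; rewrite E lee_fin.
  by rewrite ler_pdivrMl// mulr1 -lee_fin -fa le_ball_norm.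
suff : (a%:E <= a%:E * ball_norm (of_real s a^-1 \*: f))%E.
  by rewrite -{1}(mule1 a%:E) lee_pmul2l.
rewrite -{1}fa; apply: ge_ereal_sup => _ [y /= y1 <-].
have -> : rnorm (f y) = a * rnorm ((of_real s a^-1 \*: f) y).
  by rewrite E mulrA mulfV ?gt_eqF// mul1r.
by rewrite EFinM lee_pmul2l// le_ball_norm.
Qed.

End Linear.

(** In the complex case [f x = u x - i * u (i *: x)]. *)
Lemma complexification (Y : lmodType K) (u : Y -> R) :
  (forall a x y, u (of_real s a *: x + y) = a * u x + u y) ->
  exists f : {linear Y -> K^o}, forall x, realpart (f x : K) = u x.
Proof.
case: s Y u => /= Y u uP.
  pose uL := GRing.isLinear.Build R Y R^o *:%R u uP.
  by pose f : {linear Y -> R^o} := HB.pack u uL; exists f.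
have u0 : u 0 = 0.
  have := uP 1 0 0; rewrite scaler0 addr0 mul1r => /eqP.
  by rewrite -subr_eq subrr eq_sym => /eqP.
have uZ (a b : R) x y :
    u (Complex a b *: x + y) = a * u x + b * u ('i%C *: x) + u y.
  have -> : Complex a b *: x + y =
      real_complex R a *: x + (real_complex R b *: ('i%C *: x) + y).
    rewrite scalerA addrA -scalerDl; congr (_ *: _ + _).
    by apply/eqP; rewrite eq_complex/=; apply/andP; split; apply/eqP; ring.
  by rewrite !uP addrA.
pose f x : R[i]^o := Complex (u x) (- u ('i%C *: x)).
have flin : linear f.
  move=> [a b] x y; rewrite /f uZ.
  have -> : 'i%C *: (Complex a b *: x + y) = Complex (- b) a *: x + 'i%C *: y.
    rewrite scalerDr scalerA; congr (_ *: _ + _).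
    by apply/eqP; rewrite eq_complex/=; apply/andP; split; apply/eqP; ring.
  rewrite uZ; apply/eqP; rewrite eq_complex/=; apply/andP.
  by split; apply/eqP; ring.
pose fL := GRing.isLinear.Build R[i] Y R[i]^o *:%R f flin.
by pose g : {linear Y -> R[i]^o} := HB.pack f fL; exists g.
Qed.

End Functionals.

(** A type alias, so that restriction of scalars to [R] is inferred without
competing with the given module structure of [Y]. *)
Definition real_scalars (R : realType) (s : scalar_kind)
  (Y : lmodType (scalars R s)) : Type := Y.

Section RealScalars.
Variables (R : realType) (s : scalar_kind) (Y : lmodType (scalars R s)).
Local Notation V := (real_scalars Y).

HB.instance Definition _ := GRing.Zmodule.on V.

Definition real_scale (a : R) (y : V) : V := of_real s a *: (y : Y).

Lemma real_scaleA a b y : real_scale a (real_scale b y) = real_scale (a * b) y.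
Proof. by rewrite /real_scale of_realM scalerA. Qed.

Lemma real_scale1 : left_id 1 real_scale.
Proof. by move=> y; rewrite /real_scale of_real1 scale1r. Qed.

Lemma real_scaleDr : right_distributive real_scale +%R.
Proof. by move=> a x y; exact: scalerDr. Qed.

Lemma real_scaleDl y : {morph real_scale^~ y : a b / a + b}.
Proof. by move=> a b; rewrite /real_scale of_realD scalerDl. Qed.

HB.instance Definition _ := GRing.Zmodule_isLmodule.Build R V
  real_scaleA real_scale1 real_scaleDr real_scaleDl.

End RealScalars.

Lemma norming_functional (R : realType) (s : scalar_kind)
    (Y : normedModType (scalars R s)) (y : Y) :
  exists f : {linear Y -> (scalars R s)^o},
    (forall x, rnorm x <= 1 -> rnorm (f x) <= 1) /\
    realpart (f y : scalars R s) = rnorm y.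
Proof.
have [|u ule uy] := @hahn_banach R (real_scalars Y) (fun x => rnorm (x : Y)) y.
  split=> [x z|c x c0]; first exact: rnormD.
  by rewrite [leLHS](rnormZr c (x : Y)) ger0_norm.
have [|f fu] := @complexification R s Y u.
  by move=> a x z; have := linearP u a x z.
exists f; split; last by rewrite fu.
move=> x; apply: rnorm_functional_le => w w1.
by rewrite fu; exact: le_trans (ule w) w1.
Qed.

(** * Compactness of the approximate numerical ranges *)

Section Compactness.
Variables (R : realType) (s : scalar_kind).
Local Notation K := (scalars R s).

(** In the complex case the compact set is a square, the image of a product of
two segments. *)
Lemma compact_disc (M : R) :
  exists2 C : set K^o, compact C & forall z : K^o, rnorm z <= M -> C z.
Proof.
rewrite /rnorm; case: s => /=.
  exists [set` `[- M, M]]; first exact: segment_compact.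
  by move=> z; rewrite /= in_itv/= -ler_norml.
pose h (p : R * R) : R[i]^o := Complex p.1 p.2.
have hcont : continuous h.
  move=> p; apply/cvgrPdist_le => /= e e0.
  have eE : e = real_complex R (complex.Re e).
    by apply/esym/(@realpartK R ComplexScalars)/ltW.
  have e0' : 0 < complex.Re e / 2.
    by rewrite divr_gt0// -ltcR -eE.
  near=> q.
  have -> : h p - h q =
      real_complex R (p.1 - q.1) + 'i%C * real_complex R (p.2 - q.2).
    by apply/eqP; rewrite eq_complex/=; apply/andP; split; apply/eqP; ring.
  apply: le_trans (ler_normD _ _) _; rewrite normrM.
  have -> : `|'i%C : R[i]| = 1.
    by rewrite normc_def/= expr0n add0r expr1n sqrtr1.
  rewrite mul1r.
  rewrite !(@of_real_norm R ComplexScalars)/= eE -raddfD lecR [leRHS]splitr.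
  rewrite lerD//; near: q.
    have /cvgrPdist_le : (fst : R * R -> R) @ p --> p.1 by exact: cvg_fst.
    exact.
  have /cvgrPdist_le : (snd : R * R -> R) @ p --> p.2 by exact: cvg_snd.
  exact.
exists (h @` ([set` `[- M, M]] `*` [set` `[- M, M]])).
  apply: continuous_compact; first exact: continuous_subspaceT.
  by apply: compact_setX; exact: segment_compact.
move=> [a b]; rewrite -[leLHS]/(Num.sqrt (a ^+ 2 + b ^+ 2)) => zM.
exists (a, b) => //.
have aM : `|a| <= M.
  by apply: le_trans zM; rewrite -sqrtr_sqr ler_wsqrtr// lerDl sqr_ge0.
have bM : `|b| <= M.
  by apply: le_trans zM; rewrite -sqrtr_sqr ler_wsqrtr// lerDr sqr_ge0.
by split; rewrite /= in_itv/= -ler_norml.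
Unshelve. all: by end_near. Qed.

Lemma nested_closures (B : R -> set K^o) (M : R) :
  (forall d, 0 < d -> B d !=set0) ->
  (forall d e, d <= e -> B d `<=` B e) ->
  (forall d z, B d z -> rnorm z <= M) ->
  exists z, forall d, 0 < d -> closure (B d) z.
Proof.
move=> B0 Bmono BM; have [C Ccompact MC] := compact_disc M.
pose F := filter_from [set d : R | 0 < d] B.
have FF : ProperFilter F.
  apply: filter_from_proper; last by move=> d; exact: B0.
  apply: filter_from_filter; first by exists 1 => /=.
  move=> d e /= d0 e0; exists (Num.min d e); first by rewrite /= lt_min d0 e0.
  by move=> z Bz; split; apply: Bmono Bz; rewrite ge_min lexx ?orbT.
have FC : F C by exists 1 => //= z /BM; exact: MC.
have [z [_ zF]] := Ccompact F FF FC.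
by exists z => d d0 U; apply: zF; exists d.
Qed.

Lemma closure_rnorm_ge (B : set K^o) (r : R) z :
  (forall w, B w -> r <= rnorm w) -> closure B z -> r <= rnorm z.
Proof.
move=> Br Bz; apply/ler_addgt0Pr => e e0.
have eK : 0 < of_real s e by rewrite -(of_real0 R s) ltr_of_real.
have [w [Bw]] := Bz _ (nbhsx_ballx z _ eK).
rewrite -ball_normE /= -of_rnorm ltr_of_real => zw.
apply: le_trans (Br w Bw) _.
rewrite -(subrK z w) addrC; apply: le_trans (rnormD _ _) _.
by rewrite lerD2l -rnormN opprB ltW.
Qed.

End Compactness.

Section NumericalRange.
Variables (R : realType) (s : scalar_kind) (k : nat).
Local Notation K := (scalars R s).
Variables X Y : completeNormedModType K.
Implicit Types Q P : hpoly k X Y.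

Lemma approx_numerical_range_mono Q P d e : d <= e ->
  approx_numerical_range Q P d `<=` approx_numerical_range Q P e.
Proof.
move=> de t [f [x [fc f1 x1 fx ->]]]; exists f, x; split=> //.
by apply: le_lt_trans fx; rewrite lerD2l lerN2.
Qed.

Lemma approx_numerical_range_le1 Q P d t : ball_norm P = 1%E ->
  approx_numerical_range Q P d t -> rnorm t <= 1.
Proof.
move=> P1 [f [x [fc f1 x1 _ ->]]].
by apply: (ball_norm_le1 f1); apply: (ball_norm_le1 P1); rewrite x1.
Qed.

(** The supremum of moduli over the numerical range is at least any value that
the approximate ranges reach up to [e], since a cluster point of such values
lies in the range. *)
Lemma numerical_radius_ge Q P (r : R) : ball_norm P = 1%E ->
  (forall e, 0 < e ->
    exists2 t, approx_numerical_range Q P e t & r - e <= rnorm t) ->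
  (r%:E <= numerical_radius Q P)%E.
Proof.
move=> P1 H.
pose B e := approx_numerical_range Q P e `&` [set t | r - e <= rnorm t].
have [d /H[t ? ?]|d e de t [At rt]|d t [At _]|z zB] := @nested_closures R s B 1.
- by exists t.
- split; first exact: approx_numerical_range_mono At.
  by apply: le_trans rt; rewrite /= lerD2l lerN2.
- exact: approx_numerical_range_le1 At.
have rz : r <= rnorm z.
  apply/ler_addgt0Pr => e e0; rewrite -lerBlDr.
  by apply: (closure_rnorm_ge _ (zB e e0)) => w [].
apply: (@le_trans _ _ (rnorm z)%:E); first by rewrite lee_fin.
apply: ereal_sup_ubound; exists z => // d /= d0.
by apply: closure_subset (zB d d0) => w [].
Qed.

Lemma hpoly_scale P (a : R) x :
  P (of_real s a *: x) = of_real s (a ^+ k) *: P x.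
Proof. by rewrite (homogeneous_scale _ _ (hpoly_homogeneous P)) of_realX. Qed.

(** [Q] has norm one, so some unit vector is sent close to the unit sphere, and
a functional norming its image completes the pair.  As [k] is positive,
[Q] vanishes at zero, so a vector of the ball with large image can be rescaled
to norm one, which does not decrease the norm of its image. *)
Lemma approx_numerical_range_neq0 Q P d : (0 < k)%N -> ball_norm Q = 1%E ->
  0 < d -> approx_numerical_range Q P d !=set0.
Proof.
move=> k0 Q1 d0.
(* Capped at 1 so that [1 - d' < rnorm (Q x)] forces [Q x] to be nonzero. *)
pose d' := Num.min d 1.
have d'1 : d' <= 1 by rewrite ge_min lexx orbT.
have [|_ [x /= x1 <-]] := @ereal_sup_gt R
    [set (rnorm (Q x))%:E | x in [set x : X | rnorm x <= 1]] (1 - d')%:E.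
  rewrite -/(ball_norm Q) Q1 lte_fin ltrBlDr ltrDl.
  by rewrite /d' lt_min d0 ltr01.
rewrite lte_fin => Qx.
have Qx0 : 0 < rnorm (Q x) by apply: le_lt_trans Qx; rewrite subr_ge0.
have x0 : 0 < rnorm x.
  rewrite lt_neqAle rnorm_ge0 andbT eq_sym; apply: contraTN Qx0 => /eqP x0.
  have [u _ ->] := rnorm_normalize x.
  by rewrite x0 hpoly_scale expr0n gtn_eqF// of_real0 scale0r rnorm0 ltxx.
pose u := of_real s (rnorm x)^-1 *: x.
have u1 : rnorm u = 1.
  by rewrite rnormZr ger0_norm ?invr_ge0 ?rnorm_ge0// mulVf ?gt_eqF.
have Qu : rnorm (Q x) <= rnorm (Q u).
  have xk : 0 < rnorm x ^+ k by rewrite exprn_gt0.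
  rewrite hpoly_scale rnormZr exprVn ger0_norm ?invr_ge0 ?(ltW xk)//.
  by rewrite ler_pdivlMl// ler_piMl ?rnorm_ge0// exprn_ile1 ?rnorm_ge0.
have Qu0 := lt_le_trans Qx0 Qu.
have [f [f1 fQu]] := norming_functional (Q u).
exists (f (P u)), f, u; split => //.
- exact: continuous_functional f1.
- apply/eqP; rewrite eq_le; apply/andP; split.
    by apply: ge_ereal_sup => _ [y /= y1 <-]; rewrite lee_fin f1.
  pose v := of_real s (rnorm (Q u))^-1 *: Q u.
  have v1 : rnorm v = 1.
    by rewrite rnormZr ger0_norm ?invr_ge0 ?rnorm_ge0// mulVf ?gt_eqF.
  apply: (@le_trans _ _ (rnorm (f v))%:E); last by rewrite le_ball_norm ?v1.
  rewrite lee_fin; apply: le_trans (realpart_le_rnorm _).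
  by rewrite linearZ realpart_scale fQu mulVf ?gt_eqF.
- rewrite fQu; apply: lt_le_trans Qu; apply: le_lt_trans Qx.
  by rewrite lerD2l lerN2 ge_min lexx.
Qed.

End NumericalRange.

(** Let [a] be the norm of [g] and [b] that of [x].  The bound involving [Q]
gives [a * b ^+ k <= Re g (Q x) + d], while [rnorm (g (P x)) <= a * b ^+ k].
Hence the pair [(a^-1 *: g, b^-1 *: x)] norms [Q] up to
[d / (a * b ^+ k) < e], and normalizing does not decrease the value at [P]
because [a] and [b] are at most one. *)
Lemma approx_numerical_range_normalize (R : realType) (s : scalar_kind)
    (k : nat) (X Y : completeNormedModType (scalars R s))
    (Q P : hpoly k X Y) (g : {linear Y -> (scalars R s)^o}) (x : X) (d e : R) :
  (0 < k)%N -> ball_norm P = 1%E -> 0 <= d -> 0 < e -> rnorm x <= 1 ->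
  (forall w, rnorm w <= 1 -> rnorm (g w) <= 1) ->
  (forall w, rnorm w <= 1 ->
    rnorm x ^+ k * rnorm (g w) <= realpart (g (Q x) : scalars R s) + d) ->
  d < e * rnorm (g (P x)) ->
  exists2 z, approx_numerical_range Q P e z & rnorm (g (P x)) <= rnorm z.
Proof.
move=> k0 P1 d0 e0 x1 g1 gQ de; set b := rnorm x in x1 gQ.
have gP0 : 0 < rnorm (g (P x)).
  by rewrite -(pmulr_rgt0 _ e0); exact: le_lt_trans de.
have b0 : 0 < b.
  rewrite lt_neqAle rnorm_ge0 andbT eq_sym; apply: contraTN gP0 => /eqP bE.
  have [u _ ->] := rnorm_normalize x.
  by rewrite -/b bE hpoly_scale expr0n gtn_eqF// of_real0 scale0r linear0 rnorm0 ltxx.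
have bk0 : 0 < b ^+ k by rewrite exprn_gt0.
pose a := fine (ball_norm g).
have ga : ball_norm g = a%:E.
  rewrite fineK// ge0_fin_numE.
    by apply: (@le_lt_trans _ _ 1%E); rewrite ?ltry//;
      apply: ge_ereal_sup => _ [w /= w1 <-]; rewrite lee_fin g1.
  by apply: le_trans (le_ball_norm g (x := 0) _); rewrite ?rnorm0 ?lee_fin ?rnorm_ge0.
have ga_le w : rnorm w <= 1 -> rnorm (g w) <= a.
  by move=> w1; rewrite -lee_fin -ga le_ball_norm.
have a1 : a <= 1.
  by rewrite -lee_fin -ga; apply: ge_ereal_sup => _ [w /= w1 <-]; rewrite lee_fin g1.
pose u := of_real s b^-1 *: x.
have u1 : rnorm u = 1.
  by rewrite rnormZr ger0_norm ?invr_ge0 ?rnorm_ge0// mulVf ?gt_eqF.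
have gPu : rnorm (g (P x)) = b ^+ k * rnorm (g (P u)).
  rewrite hpoly_scale linearZ rnormZr exprVn.
  by rewrite ger0_norm ?invr_ge0 ?(ltW bk0)// mulrA mulfV ?mul1r ?gt_eqF.
have gPab : rnorm (g (P x)) <= a * b ^+ k.
  by rewrite gPu mulrC ler_wpM2r ?(ltW bk0)// ga_le// (ball_norm_le1 P1)// u1.
have ab0 : 0 < a * b ^+ k by exact: lt_le_trans gPab.
have a0 : 0 < a by rewrite -(pmulr_lgt0 _ bk0).
have abQ : a * b ^+ k <= realpart (g (Q x) : scalars R s) + d.
  rewrite -ler_pdivlMr// -lee_fin -ga; apply: ge_ereal_sup => _ [w /= w1 <-].
  by rewrite lee_fin ler_pdivlMr// mulrC gQ.
exists (of_real s a^-1 *: g (P u)); last first.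
  rewrite rnormZr ger0_norm ?invr_ge0 ?(ltW a0)//.
  apply: (@le_trans _ _ (rnorm (g (P u)))).
    by rewrite gPu ler_piMl ?rnorm_ge0// exprn_ile1 ?rnorm_ge0.
  by rewrite ler_peMl ?rnorm_ge0// invf_ge1.
exists (of_real s a^-1 \*: g), u; split => //.
- have ag := ball_norm_scale a0 ga.
  by apply: (@continuous_functional _ _ _ _ 1) => w; exact: ball_norm_le1.
- exact: ball_norm_scale.
- rewrite hpoly_scale linearZ /= !realpart_scale exprVn mulrCA mulrA -invfM mulrC.
  rewrite ltr_pdivlMr//.
  have : d < e * (a * b ^+ k).
    by apply: lt_le_trans de _; rewrite ler_wpM2l ?(ltW e0).
  lra.
Qed.

(** * Numerical radii in sums *)

Section Injection.
Variables (R : realType) (s : scalar_kind) (E : sum_kind) (L : choiceType).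
Local Notation K := (scalars R s).
Variable Z : L -> completeNormedModType K.

Definition injection l (u : Z l) : direct_sum E Z :=
  DirectSum (single_space E u).

Lemma injection_in l (u : Z l) : injection u l = u.
Proof. exact: dfwithin. Qed.

Lemma injection_out l (u : Z l) m : l != m -> injection u m = 0.
Proof. exact: dfwithout. Qed.

Lemma injection_linear l : linear (@injection l).
Proof.
move=> c u v; apply: direct_sum_ext => m.
transitivity (c *: injection u m + injection v m) => //.
have [<-|lm] := eqVneq l m; first by rewrite !injection_in.
by rewrite !injection_out// scaler0 addr0.
Qed.

HB.instance Definition _ l := GRing.isLinear.Build K (Z l) (direct_sum E Z)
  *:%R (@injection l) (@injection_linear l).

Lemma rnorm_injection l (u : Z l) : rnorm (injection u) = rnorm u.
Proof.
apply/eqP; rewrite eq_le; apply/andP; split.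
  by rewrite rnorm_direct_sum; exact/norm_le_psum/psum_single.
by rewrite -{1}(injection_in u) rnorm_component.
Qed.

End Injection.

Section Localization.
Variables (R : realType) (s : scalar_kind) (E : sum_kind) (L : choiceType).
Local Notation K := (scalars R s).
Variables (X Y : L -> completeNormedModType K) (k : nat) (l : L).
Variable P : hpoly k (X l) (Y l).
Hypothesis P1 : ball_norm P = 1%E.

Definition localization (x : direct_sum E X) : direct_sum E Y :=
  injection E (P (x l)).

Lemma localization_homogeneous : homogeneous k localization.
Proof.
have [A mA PA] := hpoly_homogeneous P.
exists (fun v : 'I_k -> direct_sum E X => injection E (A (fun i => v i l))); last first.
  by move=> x; rewrite /localization PA.
move=> i v c x y.
have dE (w : direct_sum E X) :
    (fun j => dfwith v i w j l) = dfwith (fun j => v j l) i (w l).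
  apply/funext => j; have [<-|ij] := eqVneq i j; first by rewrite !dfwithin.
  by rewrite !dfwithout.
by rewrite !dE -linearP; congr injection; exact: mA.
Qed.

Lemma rnorm_localization (x : direct_sum E X) :
  rnorm (localization x) = rnorm (P (x l)).
Proof. exact: rnorm_injection. Qed.

Lemma localization_continuous : continuous localization.
Proof.
apply: (homogeneous_bounded_continuous (M := 1) localization_homogeneous).
move=> x x1; rewrite rnorm_localization (ball_norm_le1 P1)//.
exact: le_trans (rnorm_component x l) x1.
Qed.

Definition localization_hpoly : hpoly k (direct_sum E X) (direct_sum E Y) :=
  HPoly localization_homogeneous localization_continuous.

Lemma localization_norm1 : ball_norm localization_hpoly = 1%E.
Proof.
rewrite -P1; apply/eqP; rewrite eq_le; apply/andP; split.
  apply: ge_ereal_sup => _ [x /= x1 <-]; rewrite rnorm_localization.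
  by apply: le_ball_norm; exact: le_trans (rnorm_component x l) x1.
apply: ge_ereal_sup => _ [u /= u1 <-].
apply: le_trans (le_ball_norm localization_hpoly (x := injection E u) _).
  by rewrite /= rnorm_localization injection_in.
by rewrite rnorm_injection.
Qed.

End Localization.

Section Comparison.
Variables (R : realType) (s : scalar_kind) (k : nat) (k0 : (0 < k)%N).
Variables (E : sum_kind) (L : choiceType).
Local Notation K := (scalars R s).
Variables (X Y : L -> completeNormedModType K).
Variables (Q : forall l, hpoly k (X l) (Y l)).
Hypothesis Q1 : forall l, ball_norm (Q l) = 1%E.
Local Notation QQ := (diagonal_hpoly E k0 Q1).

(** The vector obtained from [QQ x] by changing its coordinate [l] into one of
norm at most [rnorm (x l) ^+ k] is dominated coordinatewise by [x], hence has
norm at most one; [f] is tested on it.  Only monotonicity of the sum norm is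
involved, so the three kinds of sums are treated at once. *)
Lemma restriction_almost_normed (f : {linear direct_sum E Y -> K^o})
    (x : direct_sum E X) l (w : Y l) (d : R) :
  (forall y, rnorm y <= 1 -> rnorm (f y) <= 1) ->
  rnorm x <= 1 -> 1 - d < realpart (f (QQ x) : K) -> rnorm w <= 1 ->
  rnorm (x l) ^+ k * rnorm (f (injection E w)) <=
    realpart (f (injection E (Q l (x l))) : K) + d.
Proof.
move=> f1 x1 fQ w1; set b := rnorm (x l).
have bk0 : 0 <= b ^+ k by rewrite exprn_ge0 ?rnorm_ge0.
have powle m : rnorm (x m) ^+ k <= rnorm (x m).
  rewrite -[leRHS]expr1; apply: ler_wiXn2l; rewrite ?rnorm_ge0//.
  exact: le_trans (rnorm_component x m) x1.
pose w0 := of_real s (b ^+ k) *: w.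
have [c c1 cE] := rotation (f (injection E w0) : K).
pose w' := c *: w0.
have w'b : rnorm w' <= b ^+ k.
  by rewrite rnormZ c1 mul1r rnormZr ger0_norm// ler_piMr.
have <- : realpart (f (injection E w') : K) =
    b ^+ k * rnorm (f (injection E w)).
  have -> : injection E w' = c *: injection E w0 by rewrite -linearZ.
  rewrite linearZ /= [X in realpart X]cE of_realK.
  have -> : injection E w0 = of_real s (b ^+ k) *: injection E w.
    by rewrite -linearZ.
  by rewrite linearZ rnormZr ger0_norm.
pose y := QQ x - injection E (Q l (x l)) + injection E w'.
have y1 : rnorm y <= 1.
  apply: le_trans x1; rewrite !rnorm_direct_sum.
  apply: family_norm_mono; last exact: component_space.
  move=> m; rewrite !ger0_norm ?rnorm_ge0//.
  have -> : y m = Q m (x m) - injection E (Q l (x l)) m + injection E w' m by [].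
  have [<-|lm] := eqVneq l m.
    by rewrite !injection_in subrr add0r; exact: le_trans w'b (powle l).
  rewrite !injection_out// subr0 addr0.
  exact: le_trans (hpoly1_leX Q1 _) (powle m).
have : realpart (f y : K) <= 1.
  exact: le_trans (realpart_le_rnorm _) (f1 _ y1).
have : realpart (f y : K) = realpart (f (QQ x) : K) -
    realpart (f (injection E (Q l (x l))) : K) +
    realpart (f (injection E w') : K).
  by rewrite /y linearD linearB !realpartD realpartN.
lra.
Qed.

Lemma numerical_radius_localization l (P : hpoly k (X l) (Y l))
    (P1 : ball_norm P = 1%E) :
  (numerical_radius QQ (localization_hpoly E P1) <= numerical_radius (Q l) P)%E.
Proof.
apply: ge_ereal_sup => _ [t tV <-]; apply: numerical_radius_ge => // e e0.
have [t0|t0] := leP (rnorm t) 0.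
  have [z Az] := approx_numerical_range_neq0 P k0 (Q1 l) e0.
  by exists z => //; have := rnorm_ge0 z; lra.
(* The first bound keeps the modulus of [g (P (x l))] at least
   [rnorm t / 2], and the last one is then below [e] times that modulus. *)
pose d := Num.min (rnorm t / 2) (Num.min e (e * rnorm t / 4)).
have et0 : 0 < e * rnorm t by rewrite mulr_gt0.
have d0 : 0 < d by rewrite /d !lt_min e0 !divr_gt0.
have dt : d <= rnorm t / 2 by rewrite /d !ge_min lexx.
have de : d <= e by rewrite /d !ge_min lexx ?orbT.
have det : d <= e * rnorm t / 4 by rewrite /d !ge_min lexx ?orbT.
have dK : 0 < of_real s d by rewrite -(of_real0 R s) ltr_of_real.
have [_ [[f [x [fc f1 x1 fQ ->]]]]] := tV d d0 _ (nbhsx_ballx t _ dK).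
rewrite -ball_normE /= -of_rnorm ltr_of_real => tf.
pose g : {linear Y l -> K^o} := f \o @injection _ _ E _ Y l.
have gP : rnorm t - d <= rnorm (g (P (x l))).
  have := rnormD (t - g (P (x l))) (g (P (x l))); rewrite subrK => h.
  by move: tf; rewrite /g /= /localization => tf; lra.
have f1' y : rnorm y <= 1 -> rnorm (f y) <= 1 by exact: ball_norm_le1.
have [|w w1|w w1||z Az zge] := @approx_numerical_range_normalize _ _ _ _ _ (Q l)
  P g (x l) d e k0 P1 (ltW d0) e0.
- by rewrite -x1 rnorm_component.
- by rewrite f1'// rnorm_injection.
- by apply: restriction_almost_normed; rewrite ?x1.
- have : e * (rnorm t / 2) <= e * rnorm (g (P (x l))).
    by rewrite ler_wpM2l ?(ltW e0)//; lra.
  by lra.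
by exists z => //; lra.
Qed.

End Comparison.

(** * The numerical index of a sum *)

Theorem proposition4p1 (R : realType) (s : scalar_kind) (k : nat)
    (hk : (0 < k)%N) (E : sum_kind) (L : choiceType)
    (X Y : L -> completeNormedModType (scalars R s))
    (Q : forall l : L, hpoly k (X l) (Y l))
    (hQ : forall l : L, ball_norm (Q l) = 1%E) :
  (numerical_index (diagonal_hpoly E hk hQ)
    <= ereal_inf (range (fun l : L => numerical_index (Q l))))%E.
Proof.
apply: le_ereal_inf_tmp => _ [l _ <-]; apply: le_ereal_inf_tmp => _ [P P1 <-].
apply: (le_trans _ (numerical_radius_localization hk E hQ P1)).
by apply: ereal_inf_lbound; exists (localization_hpoly E P1);
  first exact: localization_norm1.
Qed.
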